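(* Let $\mu,\nu$ be probability measures on $\mathcal{X}$ with $\mu\ll\nu$. Assume the measurement channel is continuous in total variation: whenever $a_n\to a$ in $\mathcal{X}$, $\|h_{a_n}Q-h_aQ\|_{TV}\to0$. If the one step predictors $\pi_{n-}^\mu$ and $\pi_{n-}^\nu$ merge weakly $P^\mu$-almost surely, then the filters merge weakly in expectation: for every $f\in C_b(\mathcal{X})$, $\lim_{n\to\infty}E^\mu\left[\left|\int f\,d\pi_n^\mu-\int f\,d\pi_n^\nu\right|\right]=0$.
   Context: Setting: $\mathcal{X},\mathcal{Y},\mathcal{Z}$ are Polish spaces. $T$ is a transition kernel on $\mathcal{X}$; $\{Z_n\}$ is i.i.d. with law $Q$, independent of the states; $h:\mathcal{X}\times\mathcal{Z}\to\mathcal{Y}$ measurable, $h_x:=h(x,\cdot)$, and $h_xQ$ is the pushforward of $Q$ under $h_x$ (the conditional law of $Y_n$ given $X_n=x$). $\{X_n\}$ is a Markov chain with kernel $T$, $X_0\sim\mu$, $Y_n=h(X_n,Z_n)$; $P^\mu$, $E^\mu$ are the joint law and expectation. Predictor $\pi_{n-}^{\mu}=P^{\mu}(X_n\in\cdot\mid Y_0,\dots,Y_{n-1})$; filter $\pi_n^{\mu}=P^{\mu}(X_n\in\cdot\mid Y_0,\dots,Y_n)$. Total variation: $\|P-R\|_{TV}=\sup_{\|f\|_\infty\le1}|\int f\,dP-\int f\,dR|$ over measurable $f$. Weak merging $P^\mu$-a.s. of predictors: $P^\mu$-a.s., $|\int f d\pi_{n-}^\mu-\int f d\pi_{n-}^\nu|\to0$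 for every $f\in C_b(\mathcal{X})$. *)

(* Defs.v *)
From HB Require Import structures.
From mathcomp Require Import all_boot all_order all_algebra.
From mathcomp Require Import all_classical all_reals all_analysis.
From mathcomp Require Import measurable_realfun.
Set Implicit Arguments. Unset Strict Implicit. Unset Printing Implicit Defensive.
Import Order.TTheory GRing.Theory Num.Theory.
Import numFieldNormedType.Exports.
Local Open Scope classical_set_scope.
Local Open Scope ring_scope.

Section defs.
Variable R : realType.

Definition is_metric {T : Type} (dT : T -> T -> R) : Prop :=
  [/\ forall x y, dT x y = 0 <-> x = y,
      forall x y, dT x y = dT y x &
      forall x y z, dT x z <= dT x y + dT y z].

Definition metric_open {T : Type} (dT : T -> T -> R) (U : set T) : Prop :=
  forall x, U x -> exists2 r : R, 0 < r & [set y | dT x y < r] `<=` U.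

Definition metric_complete {T : Type} (dT : T -> T -> R) : Prop :=
  forall u : nat -> T,
    (forall e : R, 0 < e -> exists N : nat, forall m n : nat,
        (N <= m)%N -> (N <= n)%N -> dT (u m) (u n) < e) ->
    exists l : T, (fun n => dT (u n) l) @ \oo --> (0 : R).

Definition metric_separable {T : Type} (dT : T -> T -> R) : Prop :=
  exists s : nat -> T, forall x (e : R), 0 < e -> exists n, dT x (s n) < e.

Definition polish_borel {d} {T : measurableType d} (dT : T -> T -> R) : Prop :=
  [/\ is_metric dT, metric_complete dT, metric_separable dT &
      @measurable d T = <<s metric_open dT >>].

Definition metric_cvg {T : Type} (dT : T -> T -> R) (a : nat -> T) (b : T) : Prop :=
  (fun n => dT (a n) b) @ \oo --> (0 : R).

Definition Cb {T : Type} (dT : T -> T -> R) (f : T -> R) : Prop :=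
  (forall x (e : R), 0 < e ->
     exists2 del : R, 0 < del & forall y, dT x y < del -> `|f x - f y| < e) /\
  (exists M : R, forall x, `|f x| <= M).

Definition tv_dist {d} {T : measurableType d} (m1 m2 : set T -> \bar R) : \bar R :=
  ereal_sup [set (`| \int[m1]_y (g y)%:E - \int[m2]_y (g y)%:E |)%E
            | g in [set g : T -> R | measurable_fun setT g /\ forall y, `|g y| <= 1]].

Definition chan {dX dZ dY} {X : measurableType dX} {Z : measurableType dZ}
  {Y : measurableType dY} (Q : probability Z R) (h : X * Z -> Y) (x : X) :
  set Y -> \bar R := pushforward Q (fun z => h (x, z)).

Definition sig_of {dO dT} {O : measurableType dO} {T : measurableType dT}
  (I : set nat) (F : nat -> O -> T) : set_system O :=
  \bigcup_(i in I) preimage_set_system setT (F i) measurable.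

Definition obs {dO dX dZ dY} {O : measurableType dO} {X : measurableType dX}
  {Z : measurableType dZ} {Y : measurableType dY} (h : X * Z -> Y)
  (Xs : nat -> O -> X) (Zs : nat -> O -> Z) : nat -> O -> Y :=
  fun n w => h (Xs n w, Zs n w).

Definition obs_sigma {dO dX dZ dY} {O : measurableType dO} {X : measurableType dX}
  {Z : measurableType dZ} {Y : measurableType dY} (h : X * Z -> Y)
  (Xs : nat -> O -> X) (Zs : nat -> O -> Z) (n : nat) : set_system O :=
  <<s sig_of [set k | (k < n)%N] (obs h Xs Zs) >>.

(** Under P, (X_n) is a Markov chain with kernel T and initial law m, and
    (Z_n) is i.i.d. with law Q, independent of (X_n):
    - X_0 ~ m;
    - P(X_{n+1} in A | X_0..X_n) = T(X_n, A);
    - Z_n is independent of (X_k)_{k in N}, Z_0..Z_{n-1}, with law Q. *)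
Definition hmm_law {dO dX dZ} {O : measurableType dO} {X : measurableType dX}
  {Z : measurableType dZ} (P : probability O R) (m : probability X R)
  (T : R.-pker X ~> X) (Q : probability Z R)
  (Xs : nat -> O -> X) (Zs : nat -> O -> Z) : Prop :=
  [/\ forall n, measurable_fun setT (Xs n),
      forall n, measurable_fun setT (Zs n),
      forall A, measurable A -> P (Xs 0 @^-1` A) = m A,
      forall n A, measurable A -> forall G,
        <<s sig_of [set k | (k <= n)%N] Xs >> G ->
        P (G `&` Xs n.+1 @^-1` A) = (\int[P]_(w in G) T (Xs n w) A)%E &
      forall n B, measurable B -> forall G,
        <<s sig_of setT Xs `|` sig_of [set k | (k < n)%N] Zs >> G ->
        P (G `&` Zs n @^-1` B) = (P G * Q B)%E].

Definition cond_law {dO dX} {O : measurableType dO} {X : measurableType dX}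
  (P : probability O R) (F : set_system O) (V : O -> X)
  (k : O -> probability X R) : Prop :=
  (forall A : set X, measurable A -> forall B : set (\bar R), measurable B ->
     F ((fun w => k w A) @^-1` B)) /\
  (forall A : set X, measurable A -> forall G, F G ->
     P (G `&` V @^-1` A) = (\int[P]_(w in G) k w A)%E).

End defs.

(* Main.v *)
(* Fix f in C_b(X), let a_n and b_n be the integrals of f against the two
   filters, and let s_n be the sign of a_n - b_n.  Both s_n and b_n are functions
   of the past observations and of Y_n, so with
     Phi_n(x) = int s_n(h(x,z)) (f(x) - b_n(h(x,z))) Q(dz)
   one has E^mu|a_n - b_n| = E^mu[s_n (f(X_n) - b_n)] = E^mu[int Phi_n dpi_{n-}^mu].
   The same computation under P^nu shows int Phi_n dpi_{n-}^nu = 0 P^nu-a.s.,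
   hence P^mu-a.s., because P^mu << P^nu on the observations (the density is
   dmu/dnu at X_0).  So E^mu|a_n - b_n| is the mean of
   int Phi_n d(pi_{n-}^mu - pi_{n-}^nu).

   Continuity of the channel in total variation makes the functions Phi_n,
   at a fixed sample point, equicontinuous and uniformly bounded, and weak merging
   is automatically uniform over such a family: a partition of unity on which the
   Phi_n oscillate little turns the two predictors into a sequence of l^1 that
   tends weakly to zero, which by Schur's theorem tends to zero in norm.  Dominated
   convergence concludes. *)

Require Import Defs.
From HB Require Import structures.
From mathcomp Require Import all_boot all_order all_algebra.
From mathcomp Require Import all_classical all_reals all_analysis.
From mathcomp Require Import measurable_realfun.
From mathcomp Require Import ring lra zify.
Import Order.TTheory GRing.Theory Num.Theory.
Import numFieldNormedType.Exports.
Local Open Scope classical_set_scope.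
Local Open Scope ring_scope.
Set Implicit Arguments. Unset Strict Implicit. Unset Printing Implicit Defensive.

(** * Schur's theorem in l^1 *)

Section gliding_hump.
Context {R : realType}.
Implicit Types (A t c : nat -> nat -> R) (M : R).

(** Both partial sums approximate the same number [L n], obtained by taking the fixed multipliers
    [b := c n]. *)
Lemma partial_sums_dist A t c M n N N' : 0 <= M ->
  (forall n i, `|c n i| <= M) ->
  (forall b : nat -> R, (forall i, `|b i| <= M) ->
    exists2 L : nat -> R, L @ \oo --> (0 : R) &
      forall n N, `|L n - \sum_(0 <= i < N) b i * A n i| <= M * t n N) ->
  `|\sum_(0 <= i < N) c n i * A n i - \sum_(0 <= i < N') c n i * A n i|
    <= M * t n N + M * t n N'.
Proof.
move=> M0 cM /(_ (c n) (cM n))[L _ LA].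
have := lerD (LA n N) (LA n N'); apply: le_trans.
move: (\sum_(0 <= i < N) _) (\sum_(0 <= i < N') _) => a b.
have -> : a - b = (L n - b) - (L n - a) by ring.
by rewrite [leRHS]addrC; exact: ler_normB.
Qed.

(* Schur's theorem by a gliding hump: [A n] plays the role of an element of l^1,
   [t n N] bounds its norm beyond [N], and [c n] are bounded multipliers. *)
Lemma schur A t c M : 0 <= M ->
  (forall n, t n @ \oo --> (0 : R)) ->
  (forall i, A ^~ i @ \oo --> (0 : R)) ->
  (forall n i, `|c n i| <= M) ->
  (forall b : nat -> R, (forall i, `|b i| <= M) ->
    exists2 L : nat -> R, L @ \oo --> (0 : R) &
      forall n N, `|L n - \sum_(0 <= i < N) b i * A n i| <= M * t n N) ->
  forall e, 0 < e -> \forall n \near \oo, forall N,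
    `|\sum_(0 <= i < N) c n i * A n i| <= e + M * t n N.
Proof.
move=> M0 t0 A0 cM bL e e0; apply: contrapT => nbad.
have bad n0 : exists2 n, (n0 <= n)%N &
    ~ forall N, `|\sum_(0 <= i < N) c n i * A n i| <= e + M * t n N.
  apply: contrapT => hn; apply: nbad; exists n0 => // n /= n0n.
  by apply: contrapT => hN; apply: hn; exists n.
have e8 : 0 < e / 8 by rewrite divr_gt0.
(* From the last row and cutoff [u], a later row [v.1] is chosen that is small on the coordinates
   already used and beyond the new cutoff [v.2], so that its hump lies between the two cutoffs. *)
have step (u : nat * nat) : exists v : nat * nat,
    [/\ (u.1 < v.1)%N, (u.2 < v.2)%N,
        M * \sum_(0 <= i < u.2) `|A v.1 i| <= e / 8,
        M * t v.1 v.2 <= e / 8 &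
        7 * (e / 8) <= `|\sum_(0 <= i < v.2) c v.1 i * A v.1 i| ].
  case: u => n' N' /=.
  have : (fun n => M * \sum_(0 <= i < N') `|A n i|) @ \oo --> (0 : R).
    rewrite -[X in _ --> X](mulr0 M); apply: cvgMr.
    elim: N' => [|N' IH]; first by under eq_fun do rewrite big_nil; exact: cvg_cst.
    rewrite (funext (fun x => big_nat_recr _ _ _ (leq0n N'))) /=. rewrite -[X in _ --> X](addr0 (0:R)); apply: cvgD => //.
    by rewrite -[X in _ --> X](@normr0 _ R); apply: cvg_norm; exact: A0.
  move=> /cvgr0Pnorm_le /(_ _ e8) [n1 _ n1P].
  have [n n1n /existsNP[N /negP]] := bad (maxn n1 n'.+1).
  rewrite -ltNge => SN.
  have : (fun N => M * t n N) @ \oo --> (0 : R).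
    by rewrite -[X in _ --> X](mulr0 M); apply: cvgMr; exact: t0.
  move=> /cvgr0Pnorm_le /(_ _ e8) [N1 _ N1P].
  pose N2 := maxn N1 N'.+1.
  have tN2 : M * t n N2 <= e / 8.
    by apply: le_trans (ler_norm _) (N1P _ _); rewrite /= leq_maxl.
  exists (n, N2) => /=; split => //.
  - by rewrite (leq_trans _ n1n)// leq_max leqnn orbT.
  - by rewrite /N2 leq_max ltnSn orbT.
  - apply: le_trans (ler_norm _) (n1P _ _).
    by rewrite /= (leq_trans _ n1n)// leq_max leqnn.
  (* The sum up to [N] exceeds [e + M * t n N]; moving the cutoff to [N2] costs at most
     [M * t n N + e / 8], which leaves [7 * (e / 8)]. *)
  - have := @partial_sums_dist A t c M n N N2 M0 cM bL.
    have := ler_normB (\sum_(0 <= i < N) c n i * A n i - \sum_(0 <= i < N2) c n i * A n i)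
      (- \sum_(0 <= i < N2) c n i * A n i).
    rewrite normrN opprK subrK; lra.
have [next nextP] := choice step.
pose u k := iter k next (0, 0)%N.
have uS k : u k.+1 = next (u k) by [].
have n_ge k : (k <= (u k).1)%N.
  by elim: k => // k; rewrite uS; have [+ _ _ _ _] := nextP (u k); lia.
have N_ge k : (k <= (u k).2)%N.
  by elim: k => // k; rewrite uS; have [_ + _ _ _] := nextP (u k); lia.
have exk i : exists k, (i < (u k.+1).2)%N by exists i; exact: N_ge.
(* [kk i] is the block of coordinates containing [i]. The multipliers [b] copy on each block those
   of the row whose hump sits there, so one fixed sequence sees every hump. *)
pose kk i := ex_minn (exk i).
pose b i := c (u (kk i).+1).1 i.
have N_le k k' : (k <= k')%N -> ((u k).2 <= (u k').2)%N.
  elim: k' => [|k' IH]; first by rewrite leqn0 => /eqP ->.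
  rewrite leq_eqVlt => /predU1P[->//|]; rewrite ltnS => /IH h.
  by apply: leq_trans h _; rewrite uS; have [_ + _ _ _] := nextP (u k'); lia.
have kkE k i : ((u k).2 <= i)%N -> (i < (u k.+1).2)%N -> kk i = k.
  move=> ki ik; rewrite /kk; case: ex_minnP => m im mmin.
  have mk : (m <= k)%N := mmin _ ik.
  apply/eqP; rewrite eqn_leq mk /= leqNgt; apply/negP => mk'.
  by have := N_le _ _ mk'; lia.
have [L L0 LA] := bL b (fun i => cM _ _).
have e4 : 0 < e / 4 by rewrite divr_gt0.
(* Contradiction on the row of block [k]: [L n] is at most [e / 4], it is within [e / 8] of the
   [b]-sum, and the [b]-sum is within [e / 4] of the [c]-sum, which would then be at most
   [5 * (e / 8)]. *)
move/cvgr0Pnorm_le : L0 => /(_ _ e4) [k _ kP].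
have [h1 h2 h3 h4 h5] := nextP (u k); move: h1 h2 h3 h4 h5; rewrite -uS.
set n := (u k.+1).1; set N := (u k.+1).2; set N' := (u k).2 => h1 h2 h3 h4 h5.
have kn : (k <= n)%N by apply: leq_trans (n_ge k) _; exact: ltnW.
have := kP n kn; have := LA n N.
have : `|\sum_(0 <= i < N) b i * A n i - \sum_(0 <= i < N) c n i * A n i| <= e / 4.
  rewrite (big_cat_nat (leq0n N') (ltnW h2))/=.
  rewrite [X in _ - X](big_cat_nat (leq0n N') (ltnW h2))/=.
  have -> : \sum_(N' <= i < N) b i * A n i = \sum_(N' <= i < N) c n i * A n i.
    by rewrite big_nat [RHS]big_nat; apply: eq_bigr => i /andP[? ?]; rewrite /b (kkE k).
  rewrite opprD addrACA subrr addr0 -sumrB; apply: le_trans (ler_norm_sum _ _ _) _.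
  apply: (@le_trans _ _ (\sum_(0 <= i < N') 2 * M * `|A n i|)).
    apply: ler_sum => i _; rewrite -mulrBl normrM; apply: ler_wpM2r => //.
    have := ler_normB (b i) (c n i); have := cM n i.
    have : `|b i| <= M := cM _ _.
    lra.
  rewrite -big_distrr/= -mulrA; lra.
have := ler_normB (L n - \sum_(0 <= i < N) b i * A n i) (L n).
rewrite addrAC subrr add0r normrN.
have := ler_normB (\sum_(0 <= i < N) b i * A n i - \sum_(0 <= i < N) c n i * A n i) (\sum_(0 <= i < N) b i * A n i).
rewrite addrAC subrr add0r normrN.
lra.
Qed.

End gliding_hump.

(** * Integrals of bounded measurable functions against a probability *)

Section bounded_measurable.
Context {R : realType} {d : measure_display} {T : measurableType d}.
Implicit Types (f g : T -> R) (P : probability T R).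

Definition bmf f := measurable_fun setT f /\ exists M : R, forall x, `|f x| <= M.

Lemma bmf_integrable P f : bmf f -> P.-integrable setT (EFin \o f).
Proof.
move=> [mf [M fM]]; apply: measurable_bounded_integrable => //.
  by rewrite (le_lt_trans (probability_le1 P measurableT))// ltry.
exists M; split; first exact: num_real.
by move=> x Mx y _ /=; apply: le_trans (fM y) (ltW Mx).
Qed.

Lemma bmf_cst (c : R) : bmf (cst c).
Proof. by split; [exact: measurable_cst | exists `|c|]. Qed.

Lemma bmfD f g : bmf f -> bmf g -> bmf (fun x => f x + g x).
Proof.
move=> [mf [M fM]] [mg [N gN]]; split; first exact: measurable_funD.
by exists (M + N) => x; apply: le_trans (ler_normD _ _) (lerD _ _).
Qed.

Lemma bmfM f g : bmf f -> bmf g -> bmf (fun x => f x * g x).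
Proof.
move=> [mf [M fM]] [mg [N gN]]; split; first exact: measurable_funM.
by exists (M * N) => x; rewrite normrM ler_pM.
Qed.

Lemma bmfN f : bmf f -> bmf (fun x => - f x).
Proof.
move=> [mf [M fM]]; split; first exact: measurableT_comp.
by exists M => x; rewrite normrN.
Qed.

Lemma bmfB f g : bmf f -> bmf g -> bmf (fun x => f x - g x).
Proof. by move=> bf /bmfN; exact: bmfD. Qed.

Lemma bmf_sum (F : nat -> T -> R) N :
  (forall i, bmf (F i)) -> bmf (fun x => \sum_(0 <= i < N) F i x).
Proof.
move=> bF; elim: N => [|N IH].
  by under eq_fun do rewrite big_nil; exact: bmf_cst.
under eq_fun do rewrite big_nat_recr//=.
exact: bmfD.
Qed.

Lemma bmf_IntB P f g : bmf f -> bmf g ->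
  \int[P]_x (f x - g x) = \int[P]_x f x - \int[P]_x g x.
Proof. by move=> bf bg; rewrite RintegralB//; exact: bmf_integrable. Qed.

Lemma bmf_IntD P f g : bmf f -> bmf g ->
  \int[P]_x (f x + g x) = \int[P]_x f x + \int[P]_x g x.
Proof. by move=> bf bg; rewrite RintegralD//; exact: bmf_integrable. Qed.

Lemma bmf_IntZ P (c : R) f : bmf f -> \int[P]_x (c * f x) = c * \int[P]_x f x.
Proof. by move=> bf; rewrite RintegralZl//; exact: bmf_integrable. Qed.

Lemma bmf_Int_cst P (c : R) : \int[P]_x c = c.
Proof. by rewrite Rintegral_cst// [X in fine X](_ : _ = 1%E) ?mulr1//; exact: probability_setT. Qed.

Lemma bmf_Int_sum P (F : nat -> T -> R) N : (forall i, bmf (F i)) ->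
  \int[P]_x (\sum_(0 <= i < N) F i x) = \sum_(0 <= i < N) \int[P]_x F i x.
Proof.
move=> bF; elim: N => [|N IH].
  by under eq_Rintegral do rewrite big_nil; rewrite big_nil bmf_Int_cst.
under eq_Rintegral do rewrite big_nat_recr//=.
by rewrite bmf_IntD ?big_nat_recr ?IH//=; exact: bmf_sum.
Qed.

Lemma bmf_Int_le P f g : bmf f -> bmf g -> (forall x, f x <= g x) ->
  \int[P]_x f x <= \int[P]_x g x.
Proof. by move=> bf bg fg; apply: le_Rintegral => //; exact: bmf_integrable. Qed.

Lemma bmf_Int_norm P f g : bmf f -> bmf g -> (forall x, `|f x| <= g x) ->
  `|\int[P]_x f x| <= \int[P]_x g x.
Proof.
move=> bf bg fg; rewrite ler_norml; apply/andP; split.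
  rewrite -mulN1r -bmf_IntZ//; apply: bmf_Int_le => //.
    by apply: bmfM => //; exact: bmf_cst.
  by move=> x; rewrite mulN1r; have := fg x; rewrite ler_norml => /andP[].
by apply: bmf_Int_le => // x; apply: le_trans (ler_norm _) (fg x).
Qed.

Lemma bmf_Int_bound P f (M : R) : bmf f -> (forall x, `|f x| <= M) ->
  `|\int[P]_x f x| <= M.
Proof.
move=> bf fM; rewrite -[leRHS](bmf_Int_cst P).
by apply: bmf_Int_norm => //; exact: bmf_cst.
Qed.

Lemma bmf_EInt P f : bmf f -> (\int[P]_x (f x)%:E)%E = (\int[P]_x f x)%:E.
Proof.
by move=> bf; rewrite fineK//; apply: integrable_fin_num => //; exact: bmf_integrable.
Qed.

Lemma bmf_Int_cvg0 P (F : nat -> T -> R) (M : R) :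
  (forall n, bmf (F n)) -> (forall n x, `|F n x| <= M) ->
  {ae P, forall x, F ^~ x @ \oo --> (0 : R)} ->
  (fun n => \int[P]_x F n x) @ \oo --> (0 : R).
Proof.
move=> bF FM F0; apply: fine_cvg.
have := @dominated_convergence _ _ _ P setT measurableT
  (fun n => EFin \o F n) (cst 0%E) (cst M%:E).
case.
- by move=> n; apply/measurable_EFinP; have [] := bF n.
- exact: measurable_cst.
- move: F0; apply: filterS => x Fx _.
  by apply: cvg_EFin => //; apply: nearW.
- exact: (bmf_integrable P (bmf_cst M)).
- by apply: aeW => x n _ /=; rewrite lee_fin.
by move=> _ _; rewrite integral_cst ?mul0e.
Qed.

End bounded_measurable.

(** * Bounded continuous functions on a metric space *)

Section bounded_continuous.
Context {R : realType} {T : Type} {dT : T -> T -> R}.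
Implicit Types f g : T -> R.

Lemma Cb_cst (c : R) : Cb dT (cst c).
Proof.
split; last by exists `|c|.
by move=> x e e0; exists 1 => // y _; rewrite subrr normr0.
Qed.

Lemma CbD f g : Cb dT f -> Cb dT g -> Cb dT (fun x => f x + g x).
Proof.
move=> [cf [M fM]] [cg [N gN]]; split; last first.
  by exists (M + N) => x; apply: le_trans (ler_normD _ _) (lerD _ _).
move=> x e e0; have e2 : 0 < e / 2 by rewrite divr_gt0.
have [r r0 fr] := cf x _ e2; have [s s0 gs] := cg x _ e2.
exists (Num.min r s); first by rewrite lt_min r0.
move=> y; rewrite lt_min => /andP[/fr fxy /gs gxy].
rewrite opprD addrACA (splitr e).
exact: le_lt_trans (ler_normD _ _) (ltrD _ _).
Qed.

Lemma CbM f g : Cb dT f -> Cb dT g -> Cb dT (fun x => f x * g x).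
Proof.
move=> [cf [M fM]] [cg [N gN]]; split; last first.
  by exists (M * N) => x; rewrite normrM ler_pM.
move=> x e e0.
have M0 : 0 <= M := le_trans (normr_ge0 _) (fM x).
have N0 : 0 <= N := le_trans (normr_ge0 _) (gN x).
have M1 : 0 < M + 1 by lra.
have N1 : 0 < N + 1 by lra.
have [r r0 fr] := cf x (e / 2 / (N + 1)) ltac:(by rewrite !divr_gt0).
have [s s0 gs] := cg x (e / 2 / (M + 1)) ltac:(by rewrite !divr_gt0).
exists (Num.min r s); first by rewrite lt_min r0.
move=> y; rewrite lt_min => /andP[/fr fxy /gs gxy].
have -> : f x * g x - f y * g y = f x * (g x - g y) + (f x - f y) * g y by ring.
apply: le_lt_trans (ler_normD _ _) _; rewrite !normrM (splitr e).
apply: ltrD.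
  apply: (@le_lt_trans _ _ (M * `|g x - g y|)); first exact: ler_wpM2r.
  apply: (@le_lt_trans _ _ ((M + 1) * `|g x - g y|)).
    by apply: ler_wpM2r => //; lra.
  by rewrite -ltr_pdivlMl// mulrC.
apply: (@le_lt_trans _ _ (`|f x - f y| * N)); first exact: ler_wpM2l.
apply: (@le_lt_trans _ _ (`|f x - f y| * (N + 1))).
  by apply: ler_wpM2l => //; lra.
by rewrite -ltr_pdivlMr.
Qed.

Lemma CbN f : Cb dT f -> Cb dT (fun x => - f x).
Proof.
move=> /(CbM (Cb_cst (- 1))); congr (Cb dT _).
by apply/funext => x; rewrite /= mulN1r.
Qed.

Lemma CbB f g : Cb dT f -> Cb dT g -> Cb dT (fun x => f x - g x).
Proof. by move=> Cf /CbN; exact: CbD. Qed.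

Lemma Cb_sum (F : nat -> T -> R) N :
  (forall i, Cb dT (F i)) -> Cb dT (fun x => \sum_(0 <= i < N) F i x).
Proof.
move=> CF; elim: N => [|N IH].
  by under eq_fun do rewrite big_nil; exact: Cb_cst.
by under eq_fun do rewrite big_nat_recr//=; exact: CbD.
Qed.

Lemma Cb_prod (F : nat -> T -> R) N :
  (forall i, Cb dT (F i)) -> Cb dT (fun x => \prod_(0 <= i < N) F i x).
Proof.
move=> CF; elim: N => [|N IH].
  by under eq_fun do rewrite big_nil; exact: Cb_cst.
by under eq_fun do rewrite big_nat_recr//=; exact: CbM.
Qed.

(** Continuity is local while the bound is global. This serves for locally finite sums, which agree
    near each point with a finite one. *)
Lemma Cb_local f (M : R) : is_metric dT -> (forall x, `|f x| <= M) ->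
  (forall x, exists g (r : R),
    [/\ 0 < r, Cb dT g & forall y, dT x y < r -> f y = g y]) -> Cb dT f.
Proof.
move=> [d0 _ _] fM loc; split; last by exists M.
move=> x e e0; have [g [r [r0 [cg _] fg]]] := loc x.
have [s s0 gs] := cg x e e0.
exists (Num.min r s); first by rewrite lt_min r0.
move=> y; rewrite lt_min => /andP[xyr /gs].
by rewrite !fg// (d0 x x).2.
Qed.

(* One on the ball of radius [r], zero outside the ball of radius [2 r],
   where [k = 1 / r]. *)
Definition bump (k : R) (a x : T) : R :=
  Num.min 1 (Num.max 0 (2 - k * dT a x)).

Lemma bump_ge0 k a x : 0 <= bump k a x.
Proof. by rewrite /bump le_min ler01 le_max lexx. Qed.

Lemma bump_le1 k a x : bump k a x <= 1.
Proof. by rewrite /bump ge_min lexx. Qed.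

Lemma bump_eq1 k a x : k * dT a x <= 1 -> bump k a x = 1.
Proof. by move=> h; rewrite /bump (max_idPr _) ?(min_idPl _)//; lra. Qed.

Lemma bump_neq0 k a x : bump k a x != 0 -> k * dT a x < 2.
Proof.
move=> b0; rewrite ltNge; apply: contra b0 => h; apply/eqP.
by rewrite /bump (max_idPl _) ?(min_idPr _)//; lra.
Qed.

(** The function is [k]-Lipschitz: the triangle inequality gives this for [k * dT a x], and
    truncation preserves it. *)
Lemma bump_Cb k a : is_metric dT -> 0 < k -> Cb dT (bump k a).
Proof.
move=> [_ dC dtri] k0; split; last first.
  by exists 1 => x; rewrite ger0_norm ?bump_le1// bump_ge0.
move=> x e e0; exists (e / k); first by rewrite divr_gt0.
move=> y; rewrite ltr_pdivlMr// mulrC => xy.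
have h1 : k * dT a x <= k * dT a y + k * dT x y.
  by rewrite -mulrDr ler_pM2l// (dC x y).
have h2 : k * dT a y <= k * dT a x + k * dT x y.
  by rewrite -mulrDr ler_pM2l.
rewrite /bump /Num.min /Num.max; move: h1 h2 xy.
move: (k * dT a x) (k * dT a y) (k * dT x y) => p q s h1 h2 xy.
rewrite ltr_norml.
by case: (ltP 0 (2 - p)) => ?; case: (ltP 0 (2 - q)) => ?;
  do 2?[case: (ltP 1) => ?]; apply/andP; split; lra.
Qed.

End bounded_continuous.

(** Preimages of open rays are metrically open, and the open rays generate the Borel sets of the
    line. *)
Lemma Cb_bmf {R : realType} {d} {T : measurableType d} (dT : T -> T -> R) f :
  polish_borel dT -> Cb dT f -> bmf f.
Proof.
move=> [_ _ _ borel] [cf bf]; split=> //.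
apply: (measurability (@RGenOInfty.G R)).
  exact: RGenOInfty.measurableE.
move=> _ [_ [a ->] <-]; rewrite setTI borel; apply: sub_gen_smallest.
move=> x /=; rewrite in_itv/= andbT => ax.
have [r r0 fr] := cf x (f x - a) ltac:(by rewrite subr_gt0).
exists r => // y /fr; rewrite /= in_itv/= andbT ltr_norml => /andP[_].
lra.
Qed.

(** * Locally finite partitions of unity *)

Section partition_of_unity.
Context {R : realType} {T : Type} {dT : T -> T -> R}.
Variable rho : nat -> T -> R.
Hypothesis dT_metric : is_metric dT.
Hypothesis rho_Cb : forall i, Cb dT (rho i).
Hypothesis rho_ge0 : forall i x, 0 <= rho i x.
Hypothesis rho_le1 : forall i x, rho i x <= 1.
Hypothesis rho_cover : forall x, exists j (r : R),
  0 < r /\ forall y, dT x y < r -> rho j y = 1.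

(** The functions [rho i] are taken in order, each receiving its share of the mass left by the
    earlier ones; [remainder N] is what is left after the first [N], so sums of [part] telescope. *)
Definition remainder N x : R := \prod_(0 <= i < N) (1 - rho i x).
Definition part i x : R := rho i x * remainder i x.

Lemma remainderS N x : remainder N.+1 x = remainder N x - part N x.
Proof. by rewrite /part /remainder big_nat_recr//= mulrBr mulr1 mulrC. Qed.

Lemma remainder_ge0 N x : 0 <= remainder N x.
Proof. by apply: prodr_ge0 => i _; rewrite subr_ge0. Qed.

Lemma part_ge0 i x : 0 <= part i x.
Proof. by rewrite mulr_ge0// remainder_ge0. Qed.

Lemma sum_part N N' x : (N <= N')%N ->
  \sum_(N <= i < N') part i x = remainder N x - remainder N' x.
Proof.
move=> NN'; rewrite -[RHS]opprB -(telescope_sumr (remainder ^~ x) NN') -sumrN.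
by apply: eq_bigr => i _; rewrite remainderS; lra.
Qed.

Lemma remainder0 x : remainder 0 x = 1.
Proof. by rewrite /remainder big_nil. Qed.

Lemma remainder_le1 N x : remainder N x <= 1.
Proof.
rewrite -(remainder0 x) -subr_ge0 -sum_part//.
by apply: sumr_ge0 => i _; exact: part_ge0.
Qed.

Lemma remainder_eq0 j N x : rho j x = 1 -> (j < N)%N -> remainder N x = 0.
Proof.
move=> rj jN; apply/eqP; rewrite prodf_seq_eq0; apply/hasP; exists j.
  by rewrite mem_index_iota.
by rewrite /= rj subrr.
Qed.

Lemma remainder_Cb N : Cb dT (remainder N).
Proof. by apply: Cb_prod => i; apply: CbB => //; exact: Cb_cst. Qed.

Lemma part_Cb i : Cb dT (part i).
Proof. by apply: CbM => //; exact: remainder_Cb. Qed.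

Lemma remainder_cvg0 x : remainder ^~ x @ \oo --> (0 : R).
Proof.
have [j [r [r0 rj]]] := rho_cover x.
apply: cvg_near_cst.
exists j.+1 => // N /= jN; apply: (@remainder_eq0 j) => //.
by apply: rj; have [d0 _ _] := dT_metric; rewrite (d0 x x).2.
Qed.

Lemma remainder_vanish x : {j | remainder j x = 0}.
Proof.
apply: cid; have [j [r [r0 rj]]] := rho_cover x.
exists j.+1; apply: (@remainder_eq0 j) => //.
by apply: rj; have [d0 _ _] := dT_metric; rewrite (d0 x x).2.
Qed.

(* [remainder j] vanishes on a ball around [x] as soon as [rho i] is 1 there for
   some [i < j], so the partition is locally finite and [glue c] is the sum of
   the whole series of [c i * part i]. *)
Definition glue (c : nat -> R) x : R :=
  \sum_(0 <= i < sval (remainder_vanish x)) c i * part i x.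

(** A block of [part] from [m] to [n] has total mass [remainder m x - remainder n x]. It is applied
    between [N] and the index where the remainder vanishes, in whichever order they come. *)
Lemma glue_sum c (C : R) N x : (forall i, `|c i| <= C) ->
  `|glue c x - \sum_(0 <= i < N) c i * part i x| <= C * remainder N x.
Proof.
move=> cC; rewrite /glue; case: remainder_vanish => /= j j0.
have tail m n : (m <= n)%N ->
    `|\sum_(m <= i < n) c i * part i x| <= C * (remainder m x - remainder n x).
  move=> mn; rewrite -sum_part// mulr_sumr.
  apply: le_trans (ler_norm_sum _ _ _) (ler_sum _ _) => i _.
  by rewrite normrM (ger0_norm (part_ge0 _ _)) ler_wpM2r ?part_ge0.
have [Nj|/ltnW jN] := leqP N j.
  rewrite (big_cat_nat (leq0n N) Nj)/= addrAC subrr add0r.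
  by have := tail _ _ Nj; rewrite j0 subr0.
rewrite (big_cat_nat (leq0n j) jN)/= opprD addrA subrr add0r normrN.
have := tail _ _ jN; rewrite j0 => h.
apply: le_trans h _; rewrite ler_wpM2l//; last first.
  by have := remainder_ge0 N x; lra.
by apply: le_trans (cC 0%N); exact: normr_ge0.
Qed.

(** On a ball where [rho j] is 1, the error in [glue_sum] at [j.+1] vanishes, so [glue c] is a
    finite sum there. *)
Lemma glue_Cb c (C : R) : (forall i, `|c i| <= C) -> Cb dT (glue c).
Proof.
move=> cC; apply: (@Cb_local _ _ _ _ C) => // x.
  by have := glue_sum 0 x cC; rewrite big_nil subr0 remainder0 mulr1.
have [j [r [r0 rj]]] := rho_cover x.
exists (fun y => \sum_(0 <= i < j.+1) c i * part i y), r; split => //.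
  by apply: Cb_sum => i; apply: CbM; [exact: Cb_cst|exact: part_Cb].
move=> y /rj rj1; apply/eqP; rewrite -subr_eq0 -normr_le0.
have := glue_sum j.+1 y cC.
by rewrite (remainder_eq0 rj1)// mulr0.
Qed.

End partition_of_unity.

(** * Weak merging is uniform over bounded equicontinuous families *)

Section uniform_merging.
Context {R : realType} {d : measure_display} {T : measurableType d}.
Variables (dT : T -> T -> R) (p q : nat -> probability T R).
Hypothesis dT_polish : polish_borel dT.

Section approximation.
Variable rho : nat -> T -> R.
Hypothesis rho_Cb : forall i, Cb dT (rho i).

(** The pointwise estimate is integrated against each of the two probabilities, whence the factor 2.
    It is used for a glued function with [e = 0] and for [Phi n] with a small oscillation. *)
Lemma merging_approx (P Q : probability T R) f (b : nat -> R) (C e : R) N :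
  bmf f ->
  (forall x, `|f x - \sum_(0 <= i < N) b i * part rho i x|
     <= e + C * remainder rho N x) ->
  `|\int[P]_x f x - \int[Q]_x f x
     - \sum_(0 <= i < N) b i * (\int[P]_x part rho i x - \int[Q]_x part rho i x)|
  <= 2 * e + C * (\int[P]_x remainder rho N x + \int[Q]_x remainder rho N x).
Proof.
move=> bf fb.
have bpart i : bmf (part rho i) by apply: (Cb_bmf dT_polish); exact: part_Cb.
have brem i : bmf (remainder rho i).
  by apply: (Cb_bmf dT_polish); exact: remainder_Cb.
have bpartM i : bmf (fun x => b i * part rho i x) by apply: bmfM => //; exact: bmf_cst.
have one (P' : probability T R) :
    `|\int[P']_x f x - \sum_(0 <= i < N) b i * \int[P']_x part rho i x|
    <= e + C * \int[P']_x remainder rho N x.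
  have -> : \sum_(0 <= i < N) b i * \int[P']_x part rho i x =
      \int[P']_x \sum_(0 <= i < N) b i * part rho i x.
    by rewrite bmf_Int_sum//; apply: eq_bigr => i _; rewrite bmf_IntZ.
  rewrite -bmf_IntB//; last exact: bmf_sum.
  rewrite -bmf_IntZ// -[X in X + _](bmf_Int_cst P') -bmf_IntD//; last first.
  - by apply: bmfM => //; exact: bmf_cst.
  - exact: bmf_cst.
  apply: bmf_Int_norm => //; first by apply: bmfB => //; exact: bmf_sum.
  by apply: bmfD; [exact: bmf_cst|apply: bmfM => //; exact: bmf_cst].
under eq_bigr do rewrite mulrBr.
rewrite sumrB.
have := ler_normB (\int[P]_x f x - \sum_(0 <= i < N) b i * \int[P]_x part rho i x)
  (\int[Q]_x f x - \sum_(0 <= i < N) b i * \int[Q]_x part rho i x).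
have := one P; have := one Q.
rewrite opprB (addrC (_ - \int[Q]_x f x)).
move: (\int[P]_x f x) (\int[Q]_x f x) (\sum_(0 <= i < N) b i * \int[P]_x part rho i x)
  (\sum_(0 <= i < N) b i * \int[Q]_x part rho i x) => u v w z.
have -> : u - w + (z - v) = u - v - (w - z) by ring.
rewrite (addrC (- (w - z))) mulrDr; lra.
Qed.

End approximation.

(* The supports are balls around points of a dense sequence, kept only when
   every [Phi n] oscillates by at most [e] on them. *)
Lemma partition_small (Phi : nat -> T -> R) e : 0 < e ->
  (forall x (e : R), 0 < e -> exists2 del : R, 0 < del &
     forall y, dT x y < del -> forall n, `|Phi n x - Phi n y| <= e) ->
  exists (rho : nat -> T -> R) (a : nat -> T),
    [/\ forall i, Cb dT (rho i), forall i x, 0 <= rho i x,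
        forall i x, rho i x <= 1,
        forall x, exists j (r : R), 0 < r /\ forall y, dT x y < r -> rho j y = 1 &
        forall i x n, rho i x != 0 -> `|Phi n x - Phi n (a i)| <= e].
Proof.
move=> e0 equi; have [dmet _ [s sP] _] := dT_polish.
have [d0 dC dtri] := dmet.
(* A pair [(k, m)] encodes the ball of radius [2 / (m + 1)] around [s k], outside which the
   corresponding bump vanishes. Bad pairs, and indices that encode no pair, receive the zero
   function. *)
pose good (km : nat * nat) := forall x y n, km.2.+1%:R * dT (s km.1) x < 2 ->
  km.2.+1%:R * dT (s km.1) y < 2 -> `|Phi n x - Phi n y| <= e.
pose rho i x := if unpickle i is Some km then
  if `[< good km >] then bump (dT := dT) km.2.+1%:R (s km.1) x else 0 else 0.
pose a i := if unpickle i is Some km then s (km : nat * nat).1 else s 0%N.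
exists rho, a; split.
- move=> i; rewrite /rho; case: unpickle => [km|]; last exact: Cb_cst.
  by case: asboolP => _; [exact: bump_Cb|exact: Cb_cst].
- move=> i x; rewrite /rho; case: unpickle => // km.
  by case: asboolP => // _; exact: bump_ge0.
- move=> i x; rewrite /rho; case: unpickle => // km.
  by case: asboolP => // _; exact: bump_le1.
- move=> x; have [r r0 rP] := equi x (e / 2) ltac:(by rewrite divr_gt0).
  (* With [s k] within [1 / (2 (m + 1))] of [x], the ball of radius [2 / (m + 1)] around [s k] stays
     within [3 / (m + 1) < r] of [x], so the pair is good. Points [y] within the same small distance
     of [x] are within [1 / (m + 1)] of [s k], where the bump is 1. *)
  pose m := Num.truncn (3 / r).
  have mr : 3 < m.+1%:R * r.
    rewrite -ltr_pdivrMr//; exact: truncnS_gt.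
  have [k kP] := sP x ((2 * m.+1%:R)^-1) ltac:(by rewrite invr_gt0 mulr_gt0).
  have m0 : 0 < m.+1%:R :> R by [].
  have kP' : m.+1%:R * dT x (s k) < 2^-1.
    by rewrite mulrC -ltr_pdivlMr// -invfM.
  exists (pickle (k, m)), ((2 * m.+1%:R)^-1); split.
    by rewrite invr_gt0 mulr_gt0.
  move=> y xy; rewrite /rho pickleK.
  have xy' : m.+1%:R * dT x y < 2^-1.
    by rewrite mulrC -ltr_pdivlMr// -invfM.
  have goodkm : good (k, m).
    have near z : m.+1%:R * dT (s k) z < 2 -> forall n, `|Phi n x - Phi n z| <= e / 2.
      move=> kz; apply: rP; rewrite -(ltr_pM2l m0).
      apply: lt_trans mr; apply: le_lt_trans (_ : m.+1%:R * (dT x (s k) + dT (s k) z) < _).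
        by rewrite ler_pM2l.
      by rewrite mulrDr; lra.
    move=> z w n /near /(_ n) zn /near /(_ n) wn.
    have := ler_distD (Phi n x) (Phi n z) (Phi n w).
    by rewrite (distrC (Phi n z) (Phi n x)); lra.
  case: asboolP => // _; apply: bump_eq1 => /=.
  apply: (@le_trans _ _ (m.+1%:R * (dT x (s k) + dT x y))).
    by rewrite ler_pM2l// (dC x (s k)).
  by rewrite mulrDr; lra.
- move=> i x n; rewrite /rho /a; case: unpickle => [km|]; last by rewrite eqxx.
  case: asboolP => [gkm|_]; last by rewrite eqxx.
  move=> h; apply: gkm; first exact: bump_neq0 h.
  by rewrite (d0 _ _).2// mulr0.
Qed.

(** Differences of the masses given to the functions [part i] form rows [A n]. Testing the merging
    on glued functions shows that the rows tend weakly to zero, and Schur's theorem then allows the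
    multipliers [Phi n (a i)], which change with the row. *)
Lemma uniform_merging (Phi : nat -> T -> R) M :
  (forall f, Cb dT f ->
     (fun n => \int[p n]_x f x - \int[q n]_x f x) @ \oo --> (0 : R)) ->
  (forall n x, `|Phi n x| <= M) ->
  (forall x (e : R), 0 < e -> exists2 del : R, 0 < del &
     forall y, dT x y < del -> forall n, `|Phi n x - Phi n y| <= e) ->
  (fun n => \int[p n]_x Phi n x - \int[q n]_x Phi n x) @ \oo --> (0 : R).
Proof.
move=> merge PhiM equi; have [dmet _ _ _] := dT_polish.
have PhiM' n x : `|Phi n x| <= `|M| := le_trans (PhiM n x) (ler_norm M).
have bPhi n : bmf (Phi n).
  apply: (Cb_bmf dT_polish); split; last by exists M.
  move=> x e e0; have [r r0 rP] := equi x (e / 2) ltac:(by rewrite divr_gt0).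
  by exists r => // y /rP /(_ n) => h; apply: le_lt_trans h _; lra.
apply/cvgr0Pnorm_le => e e0.
(* Of the three shares [e / 3], two pay for the oscillation of [Phi n] under [p n] and [q n], and
   one for Schur's bound. *)
have [rho [a [rho_Cb rho0 rho1 rho_cover rho_osc]]] :=
  partition_small (e := e / 3) ltac:(by rewrite divr_gt0) equi.
have bpart i : bmf (part rho i) by apply: (Cb_bmf dT_polish); exact: part_Cb.
have brem i : bmf (remainder rho i).
  by apply: (Cb_bmf dT_polish); exact: remainder_Cb.
pose A n i := \int[p n]_x part rho i x - \int[q n]_x part rho i x.
pose t n N := \int[p n]_x remainder rho N x + \int[q n]_x remainder rho N x.
have t0 n : t n @ \oo --> (0 : R).
  have rem0 (P : probability T R) :
      (fun N => \int[P]_x remainder rho N x) @ \oo --> (0 : R).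
    apply: (bmf_Int_cvg0 (M := 1)) => //.
      by move=> N x; rewrite ger0_norm ?remainder_le1 ?remainder_ge0.
    by apply: aeW => x; exact: (@remainder_cvg0 _ _ dT).
  by rewrite -[X in _ --> X](addr0 (0 : R)); apply: cvgD.
have A0 i : A ^~ i @ \oo --> (0 : R) by apply: merge; exact: part_Cb.
have := @schur _ A t (fun n i => Phi n (a i)) `|M| (normr_ge0 M) t0 A0
  (fun n i => PhiM' n (a i)) _ (e / 3) ltac:(by rewrite divr_gt0).
case.
  (* The series with fixed multipliers [b] has as its limit the difference of the two integrals of
     the bounded continuous function [glue b]. *)
  move=> b bM.
  exists (fun n => \int[p n]_x glue dmet rho_cover b x - \int[q n]_x glue dmet rho_cover b x).
    by apply: merge; exact: (glue_Cb _ _ _ _ _ bM).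
  move=> n N; have := @merging_approx rho rho_Cb (p n) (q n) (glue dmet rho_cover b) b `|M| 0 N.
  rewrite mulr0 add0r; apply; first by apply: (Cb_bmf dT_polish); exact: (glue_Cb _ _ _ _ _ bM).
  by move=> x; rewrite add0r; exact: glue_sum.
move=> n0 _ n0P; exists n0 => // n /= /n0P nP.
have key N : `|\int[p n]_x Phi n x - \int[q n]_x Phi n x| <= e + `|M| * (2 * t n N).
  have := @merging_approx rho rho_Cb (p n) (q n) (Phi n) (fun i => Phi n (a i)) `|M| (e / 3) N (bPhi n).
  rewrite -/(t n N) => h2; have h1 := nP N.
  have : `|\int[p n]_x Phi n x - \int[q n]_x Phi n x -
     \sum_(0 <= i < N) Phi n (a i) * A n i| <= 2 * (e / 3) + `|M| * t n N.
    apply: h2 => x.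
    (* [Phi n x] is spread over the identity saying that the first [N] parts and [remainder N] add
       up to 1. *)
    have -> : Phi n x - \sum_(0 <= i < N) Phi n (a i) * part rho i x =
        \sum_(0 <= i < N) (Phi n x - Phi n (a i)) * part rho i x
        + Phi n x * remainder rho N x.
      under [in RHS]eq_bigr do rewrite mulrBl.
      by rewrite sumrB -mulr_sumr sum_part// remainder0; ring.
    apply: le_trans (ler_normD _ _) _; apply: lerD; last first.
      by rewrite normrM (ger0_norm (remainder_ge0 _ _ _))// ler_wpM2r ?remainder_ge0.
    apply: le_trans (ler_norm_sum _ _ _) _.
    apply: (@le_trans _ _ (\sum_(0 <= i < N) e / 3 * part rho i x)).
      apply: ler_sum => i _; rewrite normrM (ger0_norm (part_ge0 _ _ _ _))//.
      have [r0|r0] := eqVneq (rho i x) 0; first by rewrite /part r0 mul0r !mulr0.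
      by apply: ler_wpM2r; [exact: part_ge0|exact: rho_osc].
    rewrite -mulr_sumr sum_part// remainder0 ger_pMr ?divr_gt0//.
    by have := remainder_ge0 rho1 N x; lra.
  have := ler_normD (\int[p n]_x Phi n x - \int[q n]_x Phi n x -
     \sum_(0 <= i < N) Phi n (a i) * A n i) (\sum_(0 <= i < N) Phi n (a i) * A n i).
  by rewrite subrK; lra.
(* With [n] fixed, [N] tends to infinity and the tail terms disappear. *)
have : (fun N => e + `|M| * (2 * t n N)) @ \oo --> e + `|M| * (2 * 0).
  by apply: cvgD; [exact: cvg_cst|apply: cvgMr; apply: cvgMr].
rewrite !mulr0 addr0 => cv.
by apply: (cvgr_to_ge cv); exact: nearW.
Qed.

End uniform_merging.

(** * Mixtures of measures *)

Section mixture.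
Local Open Scope ereal_scope.
Context {d d' : measure_display} {D : measurableType d} {E : measurableType d'}
  {R : realType}.
Variables (P : {measure set D -> \bar R}) (l : D -> {measure set E -> \bar R}).

(** The proof [ml] is carried by the term so that the measure structure on [mixture ml] can be
    inferred from it. *)
Definition mixture
  (ml : forall U, measurable U -> measurable_fun [set: D] (fun w => l w U))
  (U : set E) : \bar R := \int[P]_w l w U.

Hypothesis ml : forall U, measurable U -> measurable_fun [set: D] (fun w => l w U).

Let mixture0 : mixture ml set0 = 0.
Proof. by apply: integral0_eq => w _; rewrite measure0. Qed.

Let mixture_ge0 U : 0 <= mixture ml U.
Proof. exact: integral_ge0. Qed.

Let mixture_sigma_additive : semi_sigma_additive (mixture ml).
Proof.
move=> F mF tF mUF; rewrite /mixture.
have -> : \int[P]_w l w (\bigcup_n F n) = \sum_(i <oo) \int[P]_w l w (F i).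
  rewrite -integral_nneseries//; last by move=> n; exact: ml.
  by apply: eq_integral => w _; rewrite measure_bigcup//; apply: eq_eseriesl => i; rewrite in_setT.
by apply: is_cvg_nneseries => n _ _; exact: integral_ge0.
Qed.

HB.instance Definition _ := isMeasure.Build _ _ _
  (mixture ml) mixture0 mixture_ge0 mixture_sigma_additive.

Import HBNNSimple.

Let integral_mixture_nnsfun (f : {nnsfun E >-> R}) :
  \int[mixture ml]_x (f x)%:E = \int[P]_w \int[l w]_x (f x)%:E.
Proof.
rewrite integralT_nnsfun sintegralE /= /mixture.
under [in RHS]eq_integral do rewrite integralT_nnsfun sintegralE.
rewrite ge0_integral_fsum//; last 2 first.
- by move=> r; apply: measurable_funeM; exact: ml.
- move=> r w _; have [r0|r0] := leP 0%R r; first by rewrite mule_ge0.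
  by rewrite preimage_nnfun0// measure0 mule0.
apply: eq_fsbigr => r _.
have [r0|r0] := leP 0%R r; first by rewrite ge0_integralZl//; exact: ml.
rewrite preimage_nnfun0// integral0_eq ?mule0 ?integral0_eq// => w _;
  by rewrite measure0 ?mule0.
Qed.

(** True for simple functions by linearity, then by monotone convergence, once under each [l w] and
    once under [P]. *)
Lemma ge0_integral_mixture f : (forall x, 0 <= f x) -> measurable_fun [set: E] f ->
  \int[mixture ml]_x f x = \int[P]_w \int[l w]_x f x.
Proof.
move=> f0 mf.
pose f_ := nnsfun_approx measurableT mf.
have fE (M : {measure set E -> \bar R}) :
    \int[M]_x f x = limn (fun n => \int[M]_x (f_ n x)%:E).
  rewrite -monotone_convergence//; last 3 first.
  - by move=> n; exact/measurable_EFinP.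
  - by move=> n z _; rewrite lee_fin.
  - by move=> z _ a b ab; rewrite lee_fin; exact/lefP/nd_nnsfun_approx.
  by apply: eq_integral => z _; apply/esym/cvg_lim => //; exact: cvg_nnsfun_approx.
rewrite fE; under eq_fun do rewrite integral_mixture_nnsfun.
rewrite -monotone_convergence//; last 3 first.
- move=> n; apply: measurable_fun_integral_kernel => //.
    by move=> z; rewrite lee_fin.
  exact/measurable_EFinP.
- by move=> n y _; apply: integral_ge0 => // z _; rewrite lee_fin.
- move=> y _ a b ab; apply: ge0_le_integral => //.
  + by move=> z _; rewrite lee_fin.
  + exact/measurable_EFinP.
  + exact/measurable_EFinP.
  + by move=> z _; rewrite lee_fin; exact/lefP/nd_nnsfun_approx.
by apply: eq_integral => w _; rewrite -fE.
Qed.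

End mixture.

(** * Probability kernels, image laws and disintegration *)

Section kernel_section.
Context {d d' : measure_display} {D : measurableType d} {E : measurableType d'}
  {R : realType}.
Variable l : D -> probability E R.
Hypothesis ml : forall U, measurable U -> measurable_fun [set: D] (fun w => l w U).

Let k : D -> {measure set E -> \bar R} := fun w => l w.
Let mk U : measurable U -> measurable_fun [set: D] (k ^~ U).
Proof. exact: ml. Qed.
HB.instance Definition _ := @isKernel.Build _ _ D E R k mk.
Let k1 w : k w [set: E] = 1%E.
Proof. exact: probability_setT. Qed.
HB.instance Definition _ := @Kernel_isProbability.Build _ _ D E R k k1.

Lemma measurable_kernel_xsection U : measurable U ->
  measurable_fun [set: D] (fun w => l w (xsection U w)).
Proof. by move=> mU; apply: (measurable_fun_xsection_finite_kernel k); rewrite inE. Qed.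

Lemma measurable_kernel_integral (f : D * E -> \bar R) :
  (forall z, 0 <= f z)%E -> measurable_fun setT f ->
  measurable_fun [set: D] (fun w => \int[l w]_x f (w, x))%E.
Proof. by move=> f0 mf; exact: (measurable_fun_integral_finite_kernel f k). Qed.

Lemma bmf_slice (F : D * E -> R) w : bmf F -> bmf (fun x => F (w, x)).
Proof. by move=> [mF [M FM]]; split; [exact: measurable_fun_pair2|exists M]. Qed.

(** Adding the bound [M] reduces measurability to the case of a nonnegative integrand. *)
Lemma bmf_kernel_integral (F : D * E -> R) : bmf F ->
  bmf (fun w => \int[l w]_x F (w, x)).
Proof.
move=> bF; have [mF [M FM]] := bF; split; last first.
  by exists M => w; apply: bmf_Int_bound => //; exact: bmf_slice.
apply/measurable_EFinP.
have F0 z : (0 <= (F z + M)%:E)%E by rewrite lee_fin; have := FM z; rewrite ler_norml; lra.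
have mFM : measurable_fun setT (fun z => (F z + M)%:E).
  by apply/measurable_EFinP; exact: measurable_funD.
rewrite [X in measurable_fun _ X](_ : _ =
    fun w => \int[l w]_x (F (w, x) + M)%:E - M%:E)%E; last first.
  apply/funext => w.
  have bFw := bmf_slice w bF.
  rewrite /= bmf_EInt; last by apply: bmfD => //; exact: bmf_cst.
  rewrite bmf_IntD//; last exact: bmf_cst.
  by rewrite bmf_Int_cst -EFinB addrK.
by apply: emeasurable_funB => //; exact: (measurable_kernel_integral F0 mFM).
Qed.

End kernel_section.

Section law.
Context {d d' : measure_display} {D : measurableType d} {E : measurableType d'}
  {R : realType}.
Implicit Type P : probability D R.

(** Packing the measurability proof with [f] yields the image measure directly as a
    [probability]. *)
Definition law P (f : D -> E) (mf : measurable_fun [set: D] f) : probability E R :=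
  distribution P (HB.pack_for {mfun D >-> E} f (isMeasurableFun.Build _ _ _ _ f mf)).

Lemma ge0_integral_law P f (mf : measurable_fun [set: D] f) (g : E -> \bar R) :
  (forall x, 0 <= g x)%E -> measurable_fun [set: E] g ->
  (\int[law P mf]_x g x = \int[P]_w g (f w))%E.
Proof.
move=> g0 mg; rewrite -[RHS](@ge0_integral_pushforward _ _ _ _ _ f mf P setT)//.
Qed.

End law.

Section disintegration.
Local Open Scope ereal_scope.
Context {dO d d' : measure_display} {O : measurableType dO}
  {D : measurableType d} {E : measurableType d'} {R : realType}.
Variables (P : probability O R) (pi : O -> D) (V : O -> E) (l : D -> probability E R).
Hypothesis mpi : measurable_fun [set: O] pi.
Hypothesis mV : measurable_fun [set: O] V.
Hypothesis ml : forall U, measurable U -> measurable_fun [set: D] (fun w => l w U).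
Hypothesis PV : forall G A, measurable G -> measurable A ->
  P (pi @^-1` G `&` V @^-1` A) = \int[P]_(w in pi @^-1` G) l (pi w) A.

(** The joint law of [(pi, V)] is compared with the mixture of the measures [l (pi w)], each placed
    on the slice over [pi w]. They agree on rectangles by [PV], hence everywhere, rectangles being a
    generating pi-system. *)
Lemma ge0_disintegration (F : D * E -> \bar R) :
  (forall z, 0 <= F z) -> measurable_fun setT F ->
  \int[P]_w F (pi w, V w) = \int[P]_w \int[l (pi w)]_x F (pi w, x).
Proof.
move=> F0 mF.
pose l' w : {measure set (D * E) -> \bar R} := law (l (pi w)) (pair1_measurable (pi w)).
have l'E w U : l' w U = l (pi w) (xsection U (pi w)) by rewrite xsectionE.
have ml' U : measurable U -> measurable_fun [set: O] (fun w => l' w U).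
  move=> mU; under eq_fun do rewrite l'E.
  exact: (measurableT_comp (measurable_kernel_xsection ml mU) mpi).
have mpiV : measurable_fun [set: O] (fun w => (pi w, V w)).
  exact: measurable_fun_pair.
rewrite -(ge0_integral_law P mpiV F0 mF).
transitivity (\int[mixture P ml']_z F z); last first.
  rewrite ge0_integral_mixture//; apply: eq_integral => w _.
  by rewrite ge0_integral_law.
apply: eq_measure_integral => U mU _.
apply: (@measure_unique _ _ _ [set A `*` B | A in measurable & B in measurable]
  (fun=> setT)) => //.
- exact: measurable_prod_measurableType.
- move=> _ _ [X1 mX1 [X2 mX2 <-]] [Y1 mY1 [Y2 mY2 <-]].
  exists (X1 `&` Y1); first exact: measurableI.
  by exists (X2 `&` Y2); [exact: measurableI|rewrite setXI].
- by move=> _; exists setT => //; exists setT => //; rewrite setXTT.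
- by apply/seteqP; split => // z _; exists 0%N.
- move=> _ [A mA [B mB <-]].
  transitivity (\int[P]_(w in pi @^-1` A) l (pi w) B); first exact: PV.
  rewrite integral_mkcond.
  apply: eq_integral => w _; rewrite l'E patchE.
  case: ifPn => [|] wA; first by rewrite in_xsectionX// inE; move: wA; rewrite inE.
  by rewrite notin_xsectionX ?measure0//; apply: contra wA; rewrite !inE.
- by move=> _; rewrite (le_lt_trans (probability_le1 _ _))// ltry.
Qed.

Lemma disintegration (F : D * E -> R) : bmf F ->
  (\int[P]_w F (pi w, V w) = \int[P]_w \int[l (pi w)]_x F (pi w, x))%R.
Proof.
move=> bF; have [mF [M FM]] := bF.
have F0 z : 0 <= (F z + M)%:E by rewrite lee_fin; have := FM z; rewrite ler_norml; lra.
have bF2 : bmf (fun w => F (pi w, V w)).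
  split; last by exists M.
  by apply: (measurableT_comp mF); exact: measurable_fun_pair.
have bInt : bmf (fun w => (\int[l (pi w)]_x F (pi w, x)))%R.
  have [mI [K IK]] := bmf_kernel_integral ml bF.
  by split; [exact: (measurableT_comp mI mpi)|exists K].
have bM (d1 : measure_display) (T : measurableType d1) := @bmf_cst R d1 T M.
(* Both sides are shifted by [M], which makes the integrand nonnegative. *)
apply: (addIr M); rewrite -[in LHS](bmf_Int_cst P M) -[in RHS](bmf_Int_cst P M).
rewrite -!bmf_IntD//.
congr fine.
rewrite (@ge0_disintegration (fun z => (F z + M)%:E))//; last first.
  by apply/measurable_EFinP; exact: measurable_funD.
apply: eq_integral => w _.
have bFw := bmf_slice (pi w) bF.
rewrite bmf_EInt; last exact: bmfD.
by rewrite bmf_IntD// bmf_Int_cst.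
Qed.

End disintegration.

Section kernel_probability.
Context {d d' : measure_display} {D : measurableType d} {E : measurableType d'}
  {R : realType}.

(** A name for the measure [T x] to which a probability structure can be attached. *)
Definition kprob (T : R.-pker D ~> E) (x : D) : set E -> \bar R := T x.

Variables (T : R.-pker D ~> E) (x : D).
HB.instance Definition _ := Measure.on (kprob T x).
Let kprob_setT : kprob T x [set: E] = 1%E.
Proof. exact: prob_kernel. Qed.
HB.instance Definition _ := Measure_isProbability.Build _ _ _ (kprob T x) kprob_setT.

End kernel_probability.

(** * Measures and integrals on generated sub-sigma-algebras *)

Section sub_sigma_algebra.
Context {dO : measure_display} {O : measurableType dO} {R : realType}.
Implicit Types S G : set_system O.

Lemma gen_sub S : S `<=` measurable -> <<s S >> `<=` @measurable _ O.
Proof. by move=> SO; apply: smallest_sub => //; exact: sigma_algebra_measurable. Qed.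

Lemma measurable_fun_gen_id S : S `<=` measurable ->
  measurable_fun [set: O] (id : O -> g_sigma_algebraType S).
Proof. by move=> /gen_sub SO _ A /SO; rewrite setTI preimage_id. Qed.

Lemma measurable_fun_gen_sub S S' : S `<=` <<s S' >> ->
  measurable_fun [set: g_sigma_algebraType S']
    (id : g_sigma_algebraType S' -> g_sigma_algebraType S).
Proof.
move=> SS' _ A mA; rewrite setTI preimage_id.
move: A mA; apply: smallest_sub => //.
exact: (@sigma_algebra_measurable _ (g_sigma_algebraType S')).
Qed.

Lemma measure_unique_gen_extend (m1 m2 : {measure set O -> \bar R}) G S
    d (E : measurableType d) (V : O -> E) :
  G `<=` measurable -> G setT -> setI_closed G ->
  measurable_fun [set: O] V -> (m1 setT < +oo)%E ->
  S `<=` G `|` preimage_set_system setT V measurable ->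
  (forall A B, G A -> measurable B -> m1 (A `&` V @^-1` B) = m2 (A `&` V @^-1` B)) ->
  forall A, <<s S >> A -> m1 A = m2 A.
Proof.
move=> Gm GT GI mV m1fin SG m12 A SA.
pose C := [set A `&` V @^-1` B | A in G & B in measurable].
have SC : S `<=` C.
  move=> U /SG [GU|[B mB <-]]; first by exists U => //; exists setT => //; rewrite preimage_setT setIT.
  by exists setT => //; exists B.
apply: (g_sigma_algebra_measure_unique C _ (fun=> setT)) => //.
- move=> _ [U GU [B mB <-]]; apply: measurableI; first exact: Gm.
  by rewrite -[_ @^-1` _]setTI; exact: mV.
- by move=> _; exists setT => //; exists setT => //; rewrite preimage_setT setIT.
- by apply/seteqP; split => // z _; exists 0%N.
- move=> _ _ [U1 G1 [B1 mB1 <-]] [U2 G2 [B2 mB2 <-]].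
  exists (U1 `&` U2); first exact: GI.
  exists (B1 `&` B2); first exact: measurableI.
  by rewrite preimage_setI setIACA.
- by move=> _ [U GU [B mB <-]]; exact: m12.
- by move=> X [sX CX]; apply: SA; split => //; exact: subset_trans SC CX.
Qed.

(** Both integrals are pushed forward by the identity to the copy of [O] carrying the coarser
    sigma-algebra, where the two measures coincide. *)
Lemma ge0_integral_sub (m1 m2 : {measure set O -> \bar R}) S (f : O -> \bar R) :
  S `<=` measurable -> (forall A, <<s S >> A -> m1 A = m2 A) ->
  (forall w, 0 <= f w)%E ->
  measurable_fun [set: g_sigma_algebraType S] (f : g_sigma_algebraType S -> _) ->
  (\int[m1]_w f w = \int[m2]_w f w)%E.
Proof.
move=> SO m12 f0 mf.
have mid := measurable_fun_gen_id SO.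
have idE (m : {measure set O -> \bar R}) :
  (\int[m]_w f w = \int[pushforward m (id : O -> g_sigma_algebraType S)]_w f w)%E.
  by rewrite (ge0_integral_pushforward mid).
rewrite !idE; apply: eq_measure_integral => A mA _; exact: m12.
Qed.

End sub_sigma_algebra.

(** * Changes of measure by a density *)

Section tilt.
Local Open Scope ereal_scope.
Context {dO : measure_display} {O : measurableType dO} {R : realType}.
Variables (P P' : probability O R) (g : O -> {nonneg R}).

Let dirac_scale w : {measure set O -> \bar R} := mscale (g w) (\d_w).

Lemma measurable_dirac_scale : measurable_fun [set: O] (fun w => (g w)%:num%R) ->
  forall U, measurable U -> measurable_fun [set: O] (fun w => dirac_scale w U).
Proof.
move=> mg U mU; apply: emeasurable_funM; first exact/measurable_EFinP.
by apply/measurable_EFinP; exact: measurable_indic.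
Qed.

Hypothesis mg : measurable_fun [set: O] (fun w => (g w)%:num%R).

(** The measure with density [g] with respect to [P], written as a mixture of Dirac masses of weight
    [g w] so that the results on mixtures apply. *)
Definition tilt : {measure set O -> \bar R} := mixture P (measurable_dirac_scale mg).

Lemma ge0_integral_tilt f : (forall w, 0 <= f w) -> measurable_fun [set: O] f ->
  \int[tilt]_w f w = \int[P]_w ((g w)%:num%:E * f w).
Proof.
move=> f0 mf; rewrite ge0_integral_mixture//; apply: eq_integral => w _.
by rewrite ge0_integral_mscale// integral_dirac// diracT mul1e.
Qed.

Lemma tilt_indic A : measurable A -> tilt A = \int[P]_w ((g w)%:num%:E * (\1_A w)%:E).
Proof. by []. Qed.

Lemma tilt_null A : measurable A -> P A = 0 -> tilt A = 0.
Proof.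
move=> mA PA; rewrite tilt_indic//.
rewrite -(@null_set_integral _ _ _ P A (fun w => (g w)%:num%:E))//; last first.
  by apply: measurable_funTS; exact/measurable_EFinP.
rewrite [RHS]integral_mkcond; apply: eq_integral => w _.
by rewrite patchE indicE; case: ifP => _; rewrite ?mule1 ?mule0.
Qed.

(** [V] has the same conditional law [l] given [S] under [P] and [P'], and the density is
    [S]-measurable. Hence [P'] and the tilt of [P], equal on [S], remain equal once [V] is
    observed. *)
Lemma tilt_extend S d (E : measurableType d) (V : O -> E)
    (l : g_sigma_algebraType S -> probability E R) :
  S `<=` measurable ->
  measurable_fun [set: g_sigma_algebraType S] (fun w : g_sigma_algebraType S => (g w)%:num%R) ->
  measurable_fun [set: O] V ->
  (forall U, measurable U -> measurable_fun [set: g_sigma_algebraType S] (fun w => l w U)) ->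
  (forall G A, <<s S >> G -> measurable A -> P (G `&` V @^-1` A) = \int[P]_(w in G) l w A) ->
  (forall G A, <<s S >> G -> measurable A -> P' (G `&` V @^-1` A) = \int[P']_(w in G) l w A) ->
  (forall G, <<s S >> G -> P' G = tilt G) ->
  forall G A, <<s S >> G -> measurable A -> P' (G `&` V @^-1` A) = tilt (G `&` V @^-1` A).
Proof.
move=> SO mgS mV ml PV PV' P'tilt G A SG mA.
have mid := measurable_fun_gen_id SO.
pose OS := g_sigma_algebraType S.
have mGS : measurable (G : set OS) by [].
have mG : measurable G by exact: gen_sub SG.
have mVA : measurable (V @^-1` A) by rewrite -[_ @^-1` _]setTI; exact: mV.
have lmS : measurable_fun [set: OS] (fun w : OS => l w A * (\1_G w)%:E).
  apply: emeasurable_funM; first exact: ml.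
  by apply/measurable_EFinP; exact: (measurable_indic (mGS)).
rewrite PV'// integral_mkcond.
transitivity (\int[P']_w (l w A * (\1_G w)%:E)).
  apply: eq_integral => w _; rewrite patchE indicE.
  by case: ifP => _; rewrite ?mule1 ?mule0.
rewrite (ge0_integral_sub SO P'tilt)//; last by move=> w; rewrite mule_ge0.
rewrite ge0_integral_tilt//; last 2 first.
- by move=> w; rewrite mule_ge0.
- exact: (measurableT_comp lmS mid).
rewrite tilt_indic; last exact: measurableI.
(* Once the integral has been moved from [P'] to [P], disintegrating this [F] under [P] turns
   [l w A] back into the indicator of [V] in [A]. *)
pose F (z : OS * E) : \bar R := (g z.1)%:num%:E * (\1_G z.1)%:E * (\1_A z.2)%:E.
have mF : measurable_fun setT F.
  apply: emeasurable_funM.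
    apply: emeasurable_funM; apply/measurable_EFinP.
      exact: (measurableT_comp mgS measurable_fst).
    exact: (measurableT_comp (measurable_indic mGS) measurable_fst).
  by apply/measurable_EFinP; exact: (measurableT_comp (measurable_indic mA) measurable_snd).
have F0 z : 0 <= F z by rewrite /F !mule_ge0.
have inner w : \int[l w]_x F (w, x) = (g w)%:num%:E * (l w A * (\1_G w)%:E).
  rewrite /F /= ge0_integralZl//=.
    by rewrite integral_indic// setIT -muleA (muleC (\1_G w)%:E).
  by apply/measurable_EFinP; exact: measurable_indic.
transitivity (\int[P]_w \int[l w]_x F (w, x)).
  by apply: eq_integral => w _; rewrite (inner w).
rewrite -(ge0_disintegration mid mV ml PV F0 mF).
apply: eq_integral => w _.
by rewrite /F /= -muleA indicI /= EFinM.
Qed.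

End tilt.

Section generated_by_family.
Context {dO dT : measure_display} {O : measurableType dO} {T : measurableType dT}.
Implicit Types (I : set nat) (F : nat -> O -> T) (S : set_system O).

Lemma sig_of_measurable I F : (forall i, measurable_fun [set: O] (F i)) ->
  sig_of I F `<=` measurable.
Proof. by move=> mF _ [i _ [B mB <-]]; exact: mF. Qed.

Lemma sig_ofS I J F : I `<=` J -> sig_of I F `<=` sig_of J F.
Proof. by move=> IJ A [i /IJ Ji FA]; exists i. Qed.

Lemma measurable_fun_sig_of I F S i : sig_of I F `<=` <<s S >> -> I i ->
  measurable_fun [set: g_sigma_algebraType S] (F i : g_sigma_algebraType S -> T).
Proof. by move=> FS Ii _ B mB; apply: FS; exists i => //; exists B. Qed.

End generated_by_family.

(** * Absolute continuity with respect to the initial law *)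

Section hmm_absolute_continuity.
Local Open Scope ereal_scope.
Context {R : realType} {dO dX dZ : measure_display} {O : measurableType dO}
  {X : measurableType dX} {Z : measurableType dZ}.
Variables (T : R.-pker X ~> X) (Q : probability Z R) (mu nu : probability X R)
  (Pmu Pnu : probability O R) (Xs : nat -> O -> X) (Zs : nat -> O -> Z).
Hypothesis mu_nu : mu `<< nu.
Hypothesis lawmu : hmm_law Pmu mu T Q Xs Zs.
Hypothesis lawnu : hmm_law Pnu nu T Q Xs Zs.

Lemma setI_closed_gen (S : set_system O) : setI_closed <<s S >>.
Proof.
by move=> A B; exact: (@measurableI _ (g_sigma_algebraType S)).
Qed.

(** The two laws share the kernel [T] and the noise law [Q], so they differ only through the density
    of [mu] at the initial state. The identity is extended one variable at a time, first over the
    states and then over the noise. *)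
Lemma hmm_null n A : <<s sig_of setT Xs `|` sig_of [set k | (k < n)%N] Zs >> A ->
  Pnu A = 0 -> Pmu A = 0.
Proof.
have [mX mZ X0mu Xmu Zmu] := lawmu; have [_ _ X0nu Xnu Znu] := lawnu.
have {}X0mu A' : measurable A' -> Pmu (Xs 0%N @^-1` A') = mu A' by exact: X0mu.
have {}X0nu A' : measurable A' -> Pnu (Xs 0%N @^-1` A') = nu A' by exact: X0nu.
have [f [f0 ffin fint fE]] := radon_nikodym_sigma_finite mu_nu.
pose r x : {nonneg R} := NngNum (fine_ge0 (f0 x)).
have rE x : (r x)%:num%:E = f x by rewrite /= fineK.
have mr : measurable_fun setT (fun x => (r x)%:num%R).
  apply/measurable_EFinP; rewrite (_ : _ \o _ = f); last by apply/funext => x; exact: rE.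
  exact: measurable_int fint.
pose g w := r (Xs 0 w).
have mg : measurable_fun [set: O] (fun w => (g w)%:num%R) by exact: (measurableT_comp mr).
have fin1 : Pmu setT < +oo by rewrite (le_lt_trans (probability_le1 _ _))// ltry.
have subX m : sig_of [set k | (k <= m)%N] Xs `<=` measurable by exact: sig_of_measurable.
have subXZ m : sig_of setT Xs `|` sig_of [set k | (k < m)%N] Zs `<=` measurable.
  by move=> U [|]; exact: sig_of_measurable.
(* [Pmu] is [Pnu] tilted by the density of [mu] at [X_0]. *)
have agreeX m : forall G, <<s sig_of [set k | (k <= m)%N] Xs >> G -> Pmu G = tilt Pnu mg G.
  elim: m => [|m IH].
    (* At time 0 nothing precedes [Xs 0], so the pi-system is reduced to [setT] and the equality is
       the Radon-Nikodym identity. *)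
    apply: (@measure_unique_gen_extend _ _ _ Pmu (tilt Pnu mg) [set setT] _ _ _ (Xs 0)) => //.
    - by move=> _ ->.
    - by move=> _ _ -> ->; rewrite /= setIT.
    - move=> _ [k + [B mB <-]]; rewrite /= leqn0 => /eqP ->.
      by right; exists B.
    - move=> _ B -> mB; rewrite setTI; transitivity (mu B); first exact: X0mu.
      rewrite fE//.
      transitivity (\int[law Pnu (mX 0%N)]_(x in B) f x).
        by apply: eq_measure_integral => U mU _; apply/esym; exact: X0nu.
      rewrite integral_mkcond ge0_integral_law//; last 2 first.
      + by move=> x; rewrite patchE; case: ifP.
      + by apply/(measurable_restrictT _ mB)/measurable_funTS; exact: measurable_int fint.
      rewrite tilt_indic//; last by rewrite -[_ @^-1` _]setTI; exact: mX.
      apply: eq_integral => w _; rewrite patchE indicE.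
      rewrite (_ : (w \in _) = (Xs 0%N w \in B)); last by apply/idP/idP; rewrite !inE.
      by rewrite /g rE; case: ifP => _; rewrite ?mule1 ?mule0.
  apply: (@measure_unique_gen_extend _ _ _ Pmu (tilt Pnu mg)
    <<s sig_of [set k | (k <= m)%N] Xs >> _ _ _ (Xs m.+1)) => //.
  - exact: gen_sub.
  - exact: (@measurableT _ (g_sigma_algebraType _)).
  - exact: setI_closed_gen.
  - move=> U [k /= + XU]; rewrite leq_eqVlt ltnS => /predU1P[km|km].
      by right; rewrite -km.
    by left; apply: sub_gen_smallest; exists k.
  apply: (@tilt_extend _ _ _ Pnu Pmu g mg _ _ _ _ (fun w => kprob T (Xs m w))) => //.
  - apply: (measurableT_comp mr).
    by apply: measurable_fun_sig_of; [exact: sub_gen_smallest|].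
  - move=> U mU; apply: (measurableT_comp (measurable_kernel T U mU)).
    by apply: measurable_fun_sig_of; [exact: sub_gen_smallest| exact: leqnn].
  - by move=> G B SG mB; exact: Xnu.
  - by move=> G B SG mB; exact: Xmu.
have agreeXZ m : forall G, <<s sig_of setT Xs `|` sig_of [set k | (k < m)%N] Zs >> G ->
    Pmu G = tilt Pnu mg G.
  elim: m => [|m IH].
    move=> G SG.
    (* Before any noise is added, the sigma-algebras of finitely many states increase, so their
       union is a pi-system generating that of the whole state sequence. *)
    apply: (g_sigma_algebra_measure_unique
      (\bigcup_m <<s sig_of [set k | (k <= m)%N] Xs >>) _ (fun=> setT)) => //.
    - by move=> U [m _]; exact: gen_sub.
    - by move=> _; exists 0%N => //; exact: (@measurableT _ (g_sigma_algebraType _)).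
    - by apply/seteqP; split => // z _; exists 0%N.
    - move=> U V [i _ Ui] [j _ Vj]; exists (maxn i j) => //.
      have mono a b W : (a <= b)%N -> <<s sig_of [set k | (k <= a)%N] Xs >> W ->
          <<s sig_of [set k | (k <= b)%N] Xs >> W.
        move=> ab SW H [sH bH]; apply: SW; split => //.
        by apply: subset_trans bH; apply: sig_ofS => k /= /leq_trans; exact.
      by apply: setI_closed_gen; [apply: mono Ui; rewrite leq_maxl|apply: mono Vj; rewrite leq_maxr].
    - by move=> U [m _]; exact: agreeX.
    - move=> H [sH bH]; apply: SG; split => // U [[k _ XU]|[]//].
      by apply: bH; exists k => //; apply: sub_gen_smallest; exists k => //=.
  apply: (@measure_unique_gen_extend _ _ _ Pmu (tilt Pnu mg)
    <<s sig_of setT Xs `|` sig_of [set k | (k < m)%N] Zs >> _ _ _ (Zs m)) => //.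
  - exact: gen_sub.
  - exact: (@measurableT _ (g_sigma_algebraType _)).
  - exact: setI_closed_gen.
  - move=> U [XU|[k /= + ZU]]; first by left; apply: sub_gen_smallest; left.
    rewrite ltnS leq_eqVlt => /predU1P[km|km]; first by right; rewrite -km.
    by left; apply: sub_gen_smallest; right; exists k.
  (* Independence says that the conditional law of [Zs m] is the constant [Q] under both laws. *)
  apply: (@tilt_extend _ _ _ Pnu Pmu g mg _ _ _ _ (fun=> Q)) => //.
  - apply: (measurableT_comp mr).
    apply: (@measurable_fun_sig_of _ _ _ _ setT) => //.
    by move=> U XU; apply: sub_gen_smallest; left.
  - move=> G B SG mB; have mG : measurable G := gen_sub (subXZ m) SG.
    rewrite integral_cst// muleC; exact: Znu.
  - move=> G B SG mB; have mG : measurable G := gen_sub (subXZ m) SG.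
    rewrite integral_cst// muleC; exact: Zmu.
move=> SA PA; rewrite (agreeXZ n)//.
by apply: tilt_null => //; exact: (gen_sub (subXZ n) SA).
Qed.

End hmm_absolute_continuity.

(** * The Doob-Dynkin factorization *)

Section doob_dynkin.
Context {R : realType} {O : pointedType} {d : measure_display} {D : measurableType d}.

(** Each level set of [b] above a rational is the preimage under [W] of a measurable set, and
    countably many such sets suffice to rebuild [b]. *)
Lemma doob_dynkin (S : set_system O) (W : O -> D) (b : O -> R) (M : R) :
  (forall A, <<s S >> A -> exists2 E, measurable E & A = W @^-1` E) ->
  measurable_fun [set: g_sigma_algebraType S] (b : g_sigma_algebraType S -> R) ->
  (forall w, `|b w| <= M) ->
  exists B : D -> R, [/\ measurable_fun setT B, forall y, `|B y| <= M &
    forall w, b w = B (W w)].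
Proof.
move=> SW mb bM.
have M0 : 0 <= M := le_trans (normr_ge0 _) (bM point).
have levelP (q : rat) : exists E : set D,
    measurable E /\ forall w, E (W w) <-> ratr q < b w.
  have /SW[E mE bE] : <<s S >> [set w | ratr q < b w].
    rewrite -[X in <<s S >> X]setTI.
    have := mb measurableT _ (measurable_itv `]ratr q, +oo[).
    by congr (<<s S >> (_ `&` _)); apply/seteqP; split => w /=; rewrite in_itv/= andbT.
  exists E; split => // w; have /seteqP[h1 h2] := bE.
  by split => [/h2|/h1].
have [E EP] := choice levelP.
(* [B y] is the supremum of the rationals [q] with [y] in [E q], clamped to [-M, M]. *)
pose q k : rat := odflt 0 (unpickle k).
pose clamp (x : R) := Num.max (- M) (Num.min M x).
have clampM x : `|clamp x| <= M.
  by rewrite ler_norml /clamp le_max lexx/= ge_max ge_min lexx; lra.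
(* Outside [E (q k)] the value is the least admissible one, [- M], so the supremum ignores that
   rational and keeps the bound [M] even off the range of [W]. *)
pose u k y : \bar R := (if y \in E (q k) then clamp (ratr (q k)) else - M)%:E.
have uM k y : (- M%:E <= u k y <= M%:E)%E.
  rewrite /u; case: ifP => _; last by rewrite -EFinN lexx lee_fin; lra.
  by have := clampM (ratr (q k)); rewrite ler_norml -EFinN !lee_fin.
have mu k : measurable_fun setT (u k).
  apply/measurable_EFinP; apply: measurable_fun_ifT => //.
  have [mE _] := EP (q k).
  apply: (measurable_fun_bool true); rewrite setTI.
  rewrite (_ : _ @^-1` _ = E (q k))//.
  by apply/seteqP; split => y; [exact: set_mem|exact: mem_set].
pose s y := esups (u ^~ y) 0.
have sM y : (- M%:E <= s y <= M%:E)%E.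
  apply/andP; split.
    apply: (@le_trans _ _ (u 0%N y)); first by have /andP[] := uM 0%N y.
    by apply: ereal_sup_ubound; exists 0%N.
  by apply: ge_ereal_sup => _ [k _ <-]; have /andP[] := uM k y.
have sfin y : s y \is a fin_num.
  by have /andP[h1 h2] := sM y; rewrite fin_numE; move: h1 h2; case: (s y).
exists (fun y => fine (s y)); split.
- apply/measurable_EFinP; rewrite (_ : _ \o _ = s).
    exact: measurable_fun_esups.
  by apply/funext => y; rewrite /= fineK.
- move=> y; rewrite ler_norml -!lee_fin fineK//.
- move=> w; apply: EFin_inj; rewrite fineK//; apply/eqP; rewrite eq_le; apply/andP; split.
    apply/lee_subgt0Pr => e e0.
    have [p] := @rat_in_itvoo R (b w - e) (b w) ltac:(by rewrite gtrBl).
    rewrite in_itv/= => /andP[bp pb].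
    apply: (@le_trans _ _ (u (pickle p) (W w))); last first.
      by apply: ereal_sup_ubound; exists (pickle p).
    rewrite /u /q pickleK/= mem_set; last by have [_ h] := EP p; apply/h.
    rewrite -EFinB lee_fin /clamp le_max le_min (ltW bp) andbT.
    have := bM w; rewrite ler_norml => /andP[h1 h2].
    by rewrite [X in _ || X](_ : _ = true) ?orbT//; lra.
  apply: ge_ereal_sup => _ [k _ <-]; rewrite /u lee_fin.
  have := bM w; rewrite ler_norml => /andP[h1 h2].
  case: ifPn => //; rewrite inE; have [_ h] := EP (q k) => /h qb.
  by rewrite /clamp ge_max h1/= ge_min (ltW qb) orbT.
Qed.

End doob_dynkin.

Section law_bounded.
Context {d d' : measure_display} {D : measurableType d} {E : measurableType d'}
  {R : realType}.

Lemma bmf_comp (f : D -> E) (g : E -> R) :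
  measurable_fun [set: D] f -> bmf g -> bmf (fun x => g (f x)).
Proof. by move=> mf [mg [M gM]]; split; [exact: measurableT_comp|exists M]. Qed.

Lemma bmf_Int_law (P : probability D R) f (mf : measurable_fun [set: D] f) (g : E -> R) :
  bmf g -> \int[law P mf]_x g x = \int[P]_w g (f w).
Proof.
move=> bg; congr fine.
rewrite -[RHS](@integral_pushforward _ _ _ _ _ f mf P setT (EFin \o g))//.
- by apply/measurable_EFinP; have [] := bg.
- by apply: (bmf_integrable P (bmf_comp mf bg)).
Qed.

End law_bounded.

(** * Equicontinuity of the observation channel *)

Section channel.
Context {R : realType} {dX dY dZ : measure_display} {X : measurableType dX}
  {Y : measurableType dY} {Z : measurableType dZ}.
Variables (dist : X -> X -> R) (Q : probability Z R) (h : X * Z -> Y).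
Hypothesis dist_metric : is_metric dist.
Hypothesis mh : measurable_fun setT h.
Hypothesis tv_cont : forall (a : nat -> X) (b : X), metric_cvg dist a b ->
  (fun n => tv_dist (chan Q h (a n)) (chan Q h b)) @ \oo --> 0%E.

(** Total variation is a supremum over all such [g], so one radius serves them all. If no radius
    worked, points within [1 / (n + 1)] of [x] would form a sequence contradicting [tv_cont]. *)
Lemma chan_equicontinuous x (e : R) : 0 < e -> exists2 del : R, 0 < del &
  forall y, dist x y < del -> forall g : Y -> R, measurable_fun setT g ->
  (forall y, `|g y| <= 1) ->
  `|\int[Q]_z g (h (x, z)) - \int[Q]_z g (h (y, z))| <= e.
Proof.
move=> e0; have [_ dC _] := dist_metric.
have [del del0 delP] : exists2 del : R, 0 < del & forall y, dist x y < del ->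
    (tv_dist (chan Q h y) (chan Q h x) <= e%:E)%E.
  apply: contrapT => far.
  have bad n : exists y, dist x y < n.+1%:R^-1 /\
      ~ (tv_dist (chan Q h y) (chan Q h x) <= e%:E)%E.
    apply: contrapT => no; apply: far; exists n.+1%:R^-1; first by rewrite invr_gt0.
    by move=> y xy; apply: contrapT => tvy; apply: no; exists y.
  have [a aP] := choice bad.
  have ax : metric_cvg dist a x.
    apply: (@squeeze_cvgr _ _ _ _ (cst 0) (fun n => n.+1%:R^-1)).
    - apply: nearW => n; have [/ltW + _] := aP n; rewrite dC => -> /=; rewrite andbT.
      have [d0 _ dtri] := dist_metric.
      have := dtri (a n) x (a n); rewrite (d0 _ _).2// (dC x); lra.
    - exact: cvg_cst.
    - exact: cvg_harmonic.
  (* Convergence in the extended reals also gives eventual finiteness, without which [fine] would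
     lose the comparison with [e]. *)
  have := tv_cont ax; move=> /fine_cvgP[fin /cvgrPdist_le /(_ e e0)] near.
  have [N _ NP] := filterI fin near.
  have [/= fN] := NP N (leqnn N).
  have [_] := aP N; rewrite sub0r normrN => + h2; apply.
  rewrite -[leLHS]fineK// lee_fin; exact: le_trans (ler_norm _) h2.
exists del => // y xy g mg g1.
have bg : bmf g by split => //; exists 1.
have mhx x' : measurable_fun setT (fun z => h (x', z)) by exact: measurable_fun_pair2.
rewrite -!(bmf_Int_law Q (mhx _) bg) distrC -lee_fin.
apply: le_trans (delP y xy).
apply: ereal_sup_ubound; exists g => //.
by rewrite -abse_EFin EFinB -!bmf_EInt.
Qed.

End channel.

(** * Conditioning on the observations *)

Section hidden_markov.
Context {R : realType} {dO dX dY dZ : measure_display} {O : measurableType dO}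
  {X : measurableType dX} {Y : measurableType dY} {Z : measurableType dZ}.
Variables (T : R.-pker X ~> X) (Q : probability Z R) (h : X * Z -> Y)
  (Xs : nat -> O -> X) (Zs : nat -> O -> Z).
Hypothesis mh : measurable_fun setT h.
Hypothesis mXs : forall n, measurable_fun setT (Xs n).
Hypothesis mZs : forall n, measurable_fun setT (Zs n).

Local Notation past n := (sig_of [set k | (k < n)%N] (obs h Xs Zs)).
Local Notation noise n := (sig_of setT Xs `|` sig_of [set k | (k < n)%N] Zs).

Lemma obs_sub_noise n : past n `<=` <<s noise n >>.
Proof.
move=> _ [k /= kn [B mB <-]].
have mX : measurable_fun [set: g_sigma_algebraType (noise n)] (Xs k).
  apply: (@measurable_fun_sig_of _ _ _ _ setT) => //.
  by move=> U XU; apply: sub_gen_smallest; left.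
have mZ : measurable_fun [set: g_sigma_algebraType (noise n)] (Zs k).
  apply: (@measurable_fun_sig_of _ _ _ _ [set k | (k < n)%N]) => //.
  by move=> U ZU; apply: sub_gen_smallest; right.
exact: (measurableT_comp mh (measurable_fun_pair mX mZ)).
Qed.

Lemma obs_measurable n : past n `<=` measurable.
Proof.
apply: sig_of_measurable => i; apply: (measurableT_comp mh).
exact: measurable_fun_pair.
Qed.

Lemma noise_measurable n : noise n `<=` measurable.
Proof. by move=> U [|]; exact: sig_of_measurable. Qed.

(** The observations up to time [n] are functions of the sample point seen through the earlier ones,
    paired with the current one; Doob-Dynkin applies to this pair. *)
Lemma obs_factor n (b : g_sigma_algebraType (past n.+1) -> R) (M : R) :
  measurable_fun setT b -> (forall w, `|b w| <= M) ->
  exists B : g_sigma_algebraType (past n) * Y -> R,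
    [/\ measurable_fun setT B, forall y, `|B y| <= M &
      forall w, b w = B (w, obs h Xs Zs n w)].
Proof.
apply: doob_dynkin => A SA.
pose W (w : O) : g_sigma_algebraType (past n) * Y := (w, obs h Xs Zs n w).
suff [E mE WE] : preimage_set_system setT W measurable A.
  by exists E => //; rewrite -WE setTI.
apply: SA; split.
  by apply: sigma_algebra_preimage; exact: sigma_algebra_measurable.
(* The newest observation is read on the second coordinate, the older ones on the first. *)
move=> _ [k /= + [B mB <-]]; rewrite ltnS leq_eqVlt => /predU1P[->|kn].
  by exists (setT `*` B); [exact: measurableX|rewrite setTX].
exists ((obs h Xs Zs k @^-1` B) `*` setT).
  apply: measurableX => //.
  by rewrite -[_ @^-1` _]setTI; apply: sub_gen_smallest; exists k => //; exists B.
by rewrite setXT.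
Qed.

Section one_law.
Variables (P : probability O R) (m : probability X R).
Hypothesis lawP : hmm_law P m T Q Xs Zs.

(** Disintegration in which the conditioning map is the identity from [O] to its copy equipped with
    the sigma-algebra of [S]. *)
Lemma cond_law_disintegration n (S : set_system O) (k : O -> probability X R)
    (F : g_sigma_algebraType S * X -> R) : S `<=` measurable ->
  cond_law P <<s S >> (Xs n) k -> bmf F ->
  \int[P]_w F (w, Xs n w) = \int[P]_w \int[k w]_x F (w, x).
Proof.
move=> Sm [mk kP] bF.
apply: (@disintegration _ _ _ _ (g_sigma_algebraType S) _ _ P id (Xs n) k) => //.
- exact: measurable_fun_gen_id.
- by move=> U mU _ B mB; rewrite setTI; exact: mk.
- by move=> G A SG mA; exact: kP.
Qed.

(** First [Zs n] is integrated out, being independent of all the states and the earlier noise, which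
    determine [Xs n] and the past observations; then [Xs n] is integrated by its conditional law
    [k]. *)
Lemma obs_joint n (k : O -> probability X R)
    (H : g_sigma_algebraType (past n) * (X * Z) -> R) :
  cond_law P (obs_sigma h Xs Zs n) (Xs n) k -> bmf H ->
  \int[P]_w H (w, (Xs n w, Zs n w)) = \int[P]_w \int[k w]_x \int[Q]_z H (w, (x, z)).
Proof.
move=> kP bH; have [_ _ _ _ ZP] := lawP.
pose F1 (y : g_sigma_algebraType (noise n) * Z) := H (y.1, (Xs n y.1, y.2)).
have mXn : measurable_fun [set: g_sigma_algebraType (noise n)] (Xs n).
  apply: (@measurable_fun_sig_of _ _ _ _ setT) => //.
  by move=> U XU; apply: sub_gen_smallest; left.
have bF1 : bmf F1.
  apply: (bmf_comp _ bH); apply: measurable_fun_pair.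
    exact: (measurableT_comp (measurable_fun_gen_sub (@obs_sub_noise n)) measurable_fst).
  apply: measurable_fun_pair => //.
  exact: (measurableT_comp mXn measurable_fst).
have := @disintegration _ _ _ _ (g_sigma_algebraType (noise n)) _ _ P id (Zs n) (fun=> Q)
  (measurable_fun_gen_id (@noise_measurable n)) (mZs n) _ _ F1 bF1.
move=> -> //; last first.
  move=> G A mG mA; have mG' : measurable (G : set O) := gen_sub (@noise_measurable n) mG.
  by rewrite integral_cst// muleC; exact: ZP.
pose F2 (y : g_sigma_algebraType (past n) * X) := \int[Q]_z H (y.1, (y.2, z)).
rewrite -(@cond_law_disintegration n (past n) k F2) //; first exact: obs_measurable.
pose H' (y : (g_sigma_algebraType (past n) * X) * Z) := H (y.1.1, (y.1.2, y.2)).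
apply: (@bmf_kernel_integral _ _ _ _ _ (fun=> Q) _ H') => //.
apply: (bmf_comp _ bH); apply: measurable_fun_pair.
  exact: (measurableT_comp measurable_fst measurable_fst).
apply: measurable_fun_pair => //.
exact: (measurableT_comp measurable_snd measurable_fst).
Qed.

End one_law.

End hidden_markov.

(** * The distance of the filters expressed by the predictors *)

Section filter_gap.
Context {R : realType} {dO dX dY dZ : measure_display} {O : measurableType dO}
  {X : measurableType dX} {Y : measurableType dY} {Z : measurableType dZ}.
Variables (T : R.-pker X ~> X) (Q : probability Z R) (h : X * Z -> Y)
  (mu nu : probability X R) (Pmu Pnu : probability O R)
  (Xs : nat -> O -> X) (Zs : nat -> O -> Z).
Hypothesis mh : measurable_fun setT h.
Hypothesis mu_nu : mu `<< nu.
Hypothesis lawmu : hmm_law Pmu mu T Q Xs Zs.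
Hypothesis lawnu : hmm_law Pnu nu T Q Xs Zs.

Local Notation past n := (sig_of [set k | (k < n)%N] (obs h Xs Zs)).

Lemma measurable_cond_law (P : probability O R) (S : set_system O) V
    (k : O -> probability X R) : cond_law P <<s S >> V k ->
  forall U, measurable U -> measurable_fun [set: g_sigma_algebraType S]
    (fun w : g_sigma_algebraType S => k w U).
Proof. by move=> [mk _] U mU _ B mB; rewrite setTI; exact: mk. Qed.

Lemma bmf_norm (f : O -> R) : bmf f -> bmf (fun w => `|f w|).
Proof.
move=> [mf [M fM]]; split; first exact: measurableT_comp.
by exists M => w; rewrite normr_id.
Qed.

Lemma bmf_cond_law (P : probability O R) (S : set_system O) V
    (k : O -> probability X R) (f : X -> R) : S `<=` measurable ->
  cond_law P <<s S >> V k -> bmf f -> bmf (fun w => \int[k w]_x f x).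
Proof.
move=> Sm kP bf.
have bf' : bmf (fun y : g_sigma_algebraType S * X => f y.2).
  exact: (bmf_comp measurable_snd bf).
exact: (bmf_comp (measurable_fun_gen_id Sm)
  (bmf_kernel_integral (measurable_cond_law kP) bf')).
Qed.

(* [s] is the sign of the difference of the filters, written as a function of
   the past observations and of the current one; the integral of [Phi w] against
   the predictor is the conditional expectation of [s (f X_n - pi_n^nu f)] given
   the past, and vanishes under the law started from [nu]. *)
Lemma filter_gap n (pmu pnu qmu qnu : O -> probability X R) (f : X -> R) (M : R) :
  cond_law Pmu (obs_sigma h Xs Zs n) (Xs n) pmu ->
  cond_law Pnu (obs_sigma h Xs Zs n) (Xs n) pnu ->
  cond_law Pmu (obs_sigma h Xs Zs n.+1) (Xs n) qmu ->
  cond_law Pnu (obs_sigma h Xs Zs n.+1) (Xs n) qnu ->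
  bmf f -> (forall x, `|f x| <= M) ->
  exists s b : O -> Y -> R,
  let Phi w x := \int[Q]_z (s w (h (x, z)) * (f x - b w (h (x, z)))) in
  [/\ forall w, measurable_fun setT (s w) /\ measurable_fun setT (b w),
      forall w y, `|s w y| <= 1 /\ `|b w y| <= M,
      bmf (fun w => \int[pmu w]_x Phi w x - \int[pnu w]_x Phi w x) &
      \int[Pmu]_w `|\int[qmu w]_x f x - \int[qnu w]_x f x| =
      \int[Pmu]_w (\int[pmu w]_x Phi w x - \int[pnu w]_x Phi w x)].
Proof.
move=> Hpmu Hpnu Hqmu Hqnu bf fM.
have [mX mZ _ _ _] := lawmu.
have pastm k : past k `<=` measurable by exact: obs_measurable.
have mid k := measurable_fun_gen_id (@pastm k).
have bmf_id k (g : g_sigma_algebraType (past k) -> R) : bmf g -> @bmf R dO O g.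
  by move=> bg; apply: (bmf_comp (mid k) bg).
pose F' := g_sigma_algebraType (past n.+1).
have bf' : bmf (fun y : F' * X => f y.2) by apply: bmf_comp bf; exact: measurable_snd.
have ba : bmf (fun w : F' => \int[qmu w]_x f x).
  exact: (bmf_kernel_integral (measurable_cond_law Hqmu) bf').
have bb : bmf (fun w : F' => \int[qnu w]_x f x).
  exact: (bmf_kernel_integral (measurable_cond_law Hqnu) bf').
(* The sign is 1 at ties, so that it never vanishes and is a measurable choice between two
   constants. *)
pose sg (w : F') : R := if \int[qnu w]_x f x <= \int[qmu w]_x f x then 1 else - 1.
have msg : measurable_fun setT sg.
  apply: measurable_fun_ifT => //; apply: measurable_fun_ler; [exact: bb.1|exact: ba.1].
have sg1 w : `|sg w| <= 1 by rewrite /sg; case: ifP => _; rewrite ?normrN normr1.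
have bM w : `|\int[qnu w]_x f x| <= M by exact: bmf_Int_bound.
have [S [mS S1 SE]] := obs_factor msg sg1.
have [B [mB BM BE]] := obs_factor bb.1 bM.
have bS : bmf S by split => //; exists 1.
have bB : bmf B by split => //; exists M.
exists (fun w y => S (w, y)), (fun w y => B (w, y)) => Phi.
pose F := g_sigma_algebraType (past n).
pose H (y : F * (X * Z)) : R := S (y.1, h y.2) * (f y.2.1 - B (y.1, h y.2)).
have mpair : measurable_fun setT (fun y : F * (X * Z) => (y.1, h y.2)).
  by apply: measurable_fun_pair => //; exact: (measurableT_comp mh measurable_snd).
have bH : bmf H.
  apply: bmfM; first exact: (bmf_comp mpair bS).
  apply: bmfB; last exact: (bmf_comp mpair bB).
  by apply: (bmf_comp _ bf); exact: (measurableT_comp measurable_fst measurable_snd).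
have HE w : H (w, (Xs n w, Zs n w)) = sg w * (f (Xs n w) - \int[qnu w]_x f x).
  by rewrite SE BE.
have bPhi : bmf (fun y : F * X => Phi y.1 y.2).
  pose H' (y : (F * X) * Z) := H (y.1.1, (y.1.2, y.2)).
  apply: (@bmf_kernel_integral _ _ _ _ _ (fun=> Q) _ H') => //.
  apply: (bmf_comp _ bH); apply: measurable_fun_pair.
    exact: (measurableT_comp measurable_fst measurable_fst).
  apply: measurable_fun_pair => //.
  exact: (measurableT_comp measurable_snd measurable_fst).
have bpsimu : bmf (fun w : F => \int[pmu w]_x Phi w x).
  exact: (bmf_kernel_integral (measurable_cond_law Hpmu) bPhi).
have bpsinu : bmf (fun w : F => \int[pnu w]_x Phi w x).
  exact: (bmf_kernel_integral (measurable_cond_law Hpnu) bPhi).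
pose psi w := \int[pnu w]_x Phi w x.
(* Testing [psi] against itself makes the vanishing integral force [psi = 0]. *)
have psi0 : \int[Pnu]_w (psi w * psi w) = 0.
  pose H2 (y : F * (X * Z)) : R := psi y.1 * H y.
  have bH2 : bmf H2 by apply: bmfM => //; exact: (bmf_comp measurable_fst bpsinu).
  have bHx w x : bmf (fun z => H (w, (x, z))).
    apply: (bmf_comp _ bH); apply: measurable_fun_pair => //; exact: measurable_fun_pair.
  transitivity (\int[Pnu]_w H2 (w, (Xs n w, Zs n w))).
    rewrite (obs_joint mh mX mZ lawnu Hpnu bH2); apply: eq_Rintegral => w _.
    rewrite -bmf_IntZ; last exact: (@bmf_slice _ _ _ _ _ (fun y : F * X => Phi y.1 y.2) w bPhi).
    by apply: eq_Rintegral => x _; apply/esym; exact: (bmf_IntZ Q (psi w) (bHx w x)).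
  (* The same integrand, now conditioned on the current observation as well: [psi] and [sg] are then
     known, and [f (Xs n)] has conditional mean equal to the integral under [qnu], so the result is
     0. *)
  pose G (y : F' * X) : R := psi y.1 * sg y.1 * (f y.2 - \int[qnu y.1]_x f x).
  have bpsi' : bmf (fun w : F' => psi w * sg w).
    apply: bmfM; last by split => //; exists 1.
    apply: (bmf_comp _ bpsinu); apply: measurable_fun_gen_sub => U XU.
    by apply: sub_gen_smallest; apply: sig_ofS XU => k /= /leqW.
  have bG : bmf G.
    apply: bmfM; first exact: (bmf_comp measurable_fst bpsi').
    by apply: bmfB => //; exact: (bmf_comp measurable_fst bb).
  transitivity (\int[Pnu]_w G (w, Xs n w)).
    by apply: eq_Rintegral => w _; rewrite /H2 /G /= HE mulrA.
  rewrite (cond_law_disintegration mX (pastm n.+1) Hqnu bG).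
  rewrite (@eq_Rintegral _ _ _ _ _ (cst 0)) ?bmf_Int_cst// => w _.
  rewrite /G /= bmf_IntZ; last by apply: bmfB => //; exact: bmf_cst.
  by rewrite bmf_IntB//; [rewrite bmf_Int_cst subrr mulr0|exact: bmf_cst].
(* The set where [psi] is nonzero is an event of the past observations, null under [Pnu], and
   [hmm_null] makes it null under [Pmu]. *)
have psimu0 : \int[Pmu]_w psi w = 0.
  have bpsi2 : bmf (fun w : F => psi w * psi w) by exact: bmfM.
  have ae0 : {ae Pmu, forall w, psi w = 0}.
    have mne : <<s past n >> [set w | psi w * psi w != 0].
      have := bpsi2.1 measurableT _ (measurableC (measurable_set1 (0 : R))).
      rewrite setTI; congr (<<s _ >> _).
      by apply/seteqP; split => w /=; [move=> /eqP|move/eqP].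
    have Pnu0 : Pnu [set w | psi w * psi w != 0] = 0%E.
      have bpsi2O := bmf_id _ _ bpsi2.
      have /ae_eq_integral_abs : (\int[Pnu]_w `|(psi w * psi w)%:E| = 0)%E.
        transitivity (\int[Pnu]_w (psi w * psi w)%:E)%E.
          by apply: eq_integral => w _; rewrite gee0_abs// lee_fin -expr2 sqr_ge0.
        by rewrite bmf_EInt// psi0.
      move=> /(_ measurableT).
      case; first exact/measurable_EFinP/bpsi2O.1.
      move=> N [mN N0 sN]; apply: (subset_measure0 _ _ _ N0) => //.
        exact: (gen_sub (@pastm n) mne).
      move=> w /= w0; apply: sN => /= /(_ I) [] /eqP; exact/negP.
    exists [set w | psi w * psi w != 0]; split.
    - exact: (gen_sub (@pastm n) mne).
    - apply: (hmm_null mu_nu lawmu lawnu (n := n)) Pnu0.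
      move: mne; apply: smallest_sub; first exact: (@sigma_algebra_measurable _ (g_sigma_algebraType _)).
      exact: obs_sub_noise.
    - by move=> w /= psiw; rewrite mulf_neq0//; apply/eqP.
  have mpsi : measurable_fun [set: O] (EFin \o psi).
    by apply/measurable_EFinP; have [] := bmf_id _ _ bpsinu.
  rewrite /Rintegral (ae_eq_integral (cst 0%E))//; first by rewrite integral0.
  by apply: filterS ae0 => w psiw _ /=; rewrite psiw.
split.
- by move=> w; split; exact: measurable_fun_pair2.
- by move=> w y; split; [exact: S1|exact: BM].
- exact: (bmf_id n _ (bmfB bpsimu bpsinu)).
rewrite (bmf_IntB Pmu (bmf_id n _ bpsimu) (bmf_id n _ bpsinu)).
rewrite psimu0 subr0 -(obs_joint mh mX mZ lawmu Hpmu bH).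
have bsg : bmf sg by split => //; exists 1.
(* Under [Pmu] the conditional mean of [f (Xs n)] is the integral under [qmu], and multiplying the
   difference by its sign gives the absolute value. *)
pose G (y : F' * X) : R := sg y.1 * (f y.2 - \int[qnu y.1]_x f x).
have bG : bmf G.
  apply: bmfM; first exact: (bmf_comp measurable_fst bsg).
  by apply: bmfB => //; exact: (bmf_comp measurable_fst bb).
transitivity (\int[Pmu]_w G (w, Xs n w)); last first.
  by apply: eq_Rintegral => w _; rewrite HE.
rewrite (cond_law_disintegration mX (pastm n.+1) Hqmu bG).
apply: eq_Rintegral => w _; rewrite /G /= bmf_IntZ; last first.
  by apply: bmfB => //; exact: bmf_cst.
rewrite bmf_IntB//; last exact: bmf_cst.
rewrite bmf_Int_cst /sg; case: ifP => [le|/negbT]; first by rewrite mul1r ger0_norm ?subr_ge0.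
by rewrite -ltNge => lt; rewrite mulN1r ltr0_norm ?subr_lt0.
Qed.

End filter_gap.

(** * Equicontinuity of the averaged test functions and passage to the limit *)

Unset Implicit Arguments.

Theorem theorem4 (R : realType) (kX kY kZ kO : measure_display)
  (X : measurableType kX) (Y : measurableType kY) (Z : measurableType kZ)
  (distX : X -> X -> R) (distY : Y -> Y -> R) (distZ : Z -> Z -> R)
  (polX : polish_borel distX) (polY : polish_borel distY)
  (polZ : polish_borel distZ)
  (T : R.-pker X ~> X) (Q : probability Z R)
  (h : X * Z -> Y) (mh : measurable_fun setT h)
  (mu nu : probability X R) (mu_ac_nu : mu `<< nu)
  (O : measurableType kO) (Pmu Pnu : probability O R)
  (Xs : nat -> O -> X) (Zs : nat -> O -> Z)
  (lawmu : hmm_law Pmu mu T Q Xs Zs) (lawnu : hmm_law Pnu nu T Q Xs Zs)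
  (tv_cont : forall (a : nat -> X) (b : X), metric_cvg distX a b ->
     (fun n => tv_dist (chan Q h (a n)) (chan Q h b)) @ \oo --> 0%E)
  (predmu prednu filtmu filtnu : nat -> O -> probability X R)
  (Hpredmu : forall n, cond_law Pmu (obs_sigma h Xs Zs n) (Xs n) (predmu n))
  (Hprednu : forall n, cond_law Pnu (obs_sigma h Xs Zs n) (Xs n) (prednu n))
  (Hfiltmu : forall n, cond_law Pmu (obs_sigma h Xs Zs n.+1) (Xs n) (filtmu n))
  (Hfiltnu : forall n, cond_law Pnu (obs_sigma h Xs Zs n.+1) (Xs n) (filtnu n))
  (pred_merge : {ae Pmu, forall w, forall f : X -> R, Cb distX f ->
     (fun n => \int[predmu n w]_x (f x)%:E - \int[prednu n w]_x (f x)%:E)%E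
       @ \oo --> 0%E}) :
  forall f : X -> R, Cb distX f ->
    (fun n => \int[Pmu]_w
        `| \int[filtmu n w]_x (f x)%:E - \int[filtnu n w]_x (f x)%:E |)%E
      @ \oo --> 0%E.
Proof.
move=> f Cf; have bf := Cb_bmf polX Cf; have [cf [M fM]] := Cf.
have M0 : 0 <= M := le_trans (normr_ge0 _) (fM point).
have [Xmet _ _ _] := polX.
pose Phi (s b : O -> Y -> R) w x :=
  \int[Q]_z (s w (h (x, z)) * (f x - b w (h (x, z)))).
have gap n : exists sb : (O -> Y -> R) * (O -> Y -> R),
  [/\ forall w, measurable_fun setT (sb.1 w) /\ measurable_fun setT (sb.2 w),
      forall w y, `|sb.1 w y| <= 1 /\ `|sb.2 w y| <= M,
      bmf (fun w => \int[predmu n w]_x Phi sb.1 sb.2 w x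
                    - \int[prednu n w]_x Phi sb.1 sb.2 w x) &
      \int[Pmu]_w `|\int[filtmu n w]_x f x - \int[filtnu n w]_x f x| =
      \int[Pmu]_w (\int[predmu n w]_x Phi sb.1 sb.2 w x
                   - \int[prednu n w]_x Phi sb.1 sb.2 w x)].
  have [s [b sbP]] := filter_gap mh mu_ac_nu lawmu lawnu (Hpredmu n) (Hprednu n)
    (Hfiltmu n) (Hfiltnu n) bf fM.
  by exists (s, b).
have [sb sbP] := choice gap.
pose Psi n w x := Phi (sb n).1 (sb n).2 w x.
have bs n w : bmf ((sb n).1 w).
  by have [m1 b1 _ _] := sbP n; split; [exact: (m1 w).1|exists 1 => y; exact: (b1 w y).1].
have bb n w : bmf ((sb n).2 w).
  by have [m1 b1 _ _] := sbP n; split; [exact: (m1 w).2|exists M => y; exact: (b1 w y).2].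
have mhx x : measurable_fun setT (fun z => h (x, z)) by exact: measurable_fun_pair2.
have bhs n w x : bmf (fun z => (sb n).1 w (h (x, z))) := bmf_comp (mhx x) (bs n w).
have bhsb n w x : bmf (fun z => (sb n).1 w (h (x, z)) * (sb n).2 w (h (x, z))).
  exact: bmfM (bhs n w x) (bmf_comp (mhx x) (bb n w)).
(* Separating [f x] leaves two channel integrals of functions of the observation alone, to which
   [chan_equicontinuous] applies uniformly in [n]. *)
have PsiE n w x : Psi n w x = f x * \int[Q]_z (sb n).1 w (h (x, z))
    - \int[Q]_z ((sb n).1 w (h (x, z)) * (sb n).2 w (h (x, z))).
  rewrite -bmf_IntZ// -bmf_IntB//; last by apply: bmfM => //; exact: bmf_cst.
  by apply: eq_Rintegral => z _; ring.
have PsiM n w x : `|Psi n w x| <= 2 * M.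
  have [_ b1 _ _] := sbP n.
  apply: bmf_Int_bound.
    apply: bmfM => //; apply: bmfB; first exact: bmf_cst.
    exact: (bmf_comp (mhx x) (bb n w)).
  move=> z; have [s1 bM] := b1 w (h (x, z)).
  rewrite normrM -[leRHS]mul1r ler_pM//.
  by apply: le_trans (ler_normB _ _) _; have := fM x; lra.
have equi w x (e : R) : 0 < e -> exists2 del : R, 0 < del &
    forall y, distX x y < del -> forall n, `|Psi n w x - Psi n w y| <= e.
  move=> e0; have e3 : 0 < e / 3 by rewrite divr_gt0.
  have e3M : 0 < e / 3 / (M + 1) by rewrite divr_gt0//; lra.
  have [r r0 rP] := cf x _ e3.
  have [q q0 qP] := chan_equicontinuous Xmet mh tv_cont x e3M.
  exists (Num.min r q); first by rewrite lt_min r0.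
  move=> y; rewrite lt_min => /andP[/rP fxy /qP gxy] n.
  have [_ b1 _ _] := sbP n.
  have sxy : `|\int[Q]_z (sb n).1 w (h (x, z)) - \int[Q]_z (sb n).1 w (h (y, z))|
      <= e / 3 / (M + 1).
    by apply: gxy; [have [] := bs n w|move=> u; have [] := b1 w u].
  have sbxy : `|\int[Q]_z ((sb n).1 w (h (x, z)) * (sb n).2 w (h (x, z)))
      - \int[Q]_z ((sb n).1 w (h (y, z)) * (sb n).2 w (h (y, z)))| <= e / 3.
    (* Rescaling puts the product in the unit ball of test functions; [M + 1] is used because [M]
       may be 0. *)
    pose g u := (M + 1)^-1 * ((sb n).1 w u * (sb n).2 w u).
    have bg : bmf g by apply: bmfM; [exact: bmf_cst|exact: bmfM].
    have : `|\int[Q]_z g (h (x, z)) - \int[Q]_z g (h (y, z))| <= e / 3 / (M + 1).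
      apply: gxy; first by have [] := bg.
      move=> u; have [s1 bM] := b1 w u.
      rewrite /g !normrM ger0_norm ?invr_ge0; last by lra.
      rewrite mulrC ler_pdivrMr ?mul1r; last by lra.
      apply: (@le_trans _ _ (1 * M)); [exact: ler_pM|lra].
    rewrite /g !bmf_IntZ// -mulrBr normrM ger0_norm ?invr_ge0; last by lra.
    by rewrite mulrC ler_pM2r// invr_gt0; lra.
  rewrite !PsiE.
  have sy1 : `|\int[Q]_z (sb n).1 w (h (y, z))| <= 1.
    by apply: bmf_Int_bound => // z; have [] := b1 w (h (y, z)).
  move: sxy sbxy sy1.
  move: (\int[Q]_z (sb n).1 w (h (x, z))) (\int[Q]_z (sb n).1 w (h (y, z)))
    (\int[Q]_z ((sb n).1 w (h (x, z)) * (sb n).2 w (h (x, z))))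
    (\int[Q]_z ((sb n).1 w (h (y, z)) * (sb n).2 w (h (y, z)))) => u v p k uv pk v1.
  (* Each of the three terms is at most [e / 3]: by variation of the channel, by continuity of [f],
     and by variation of the channel again. *)
  have -> : f x * u - p - (f y * v - k) =
      f x * (u - v) + (f x - f y) * v - (p - k) by ring.
  apply: le_trans (ler_normB _ _) _.
  have := ler_normD (f x * (u - v)) ((f x - f y) * v).
  rewrite !normrM.
  have h1 : `|f x| * `|u - v| <= e / 3.
    apply: (@le_trans _ _ ((M + 1) * (e / 3 / (M + 1)))).
      by apply: ler_pM => //; have := fM x; lra.
    by rewrite mulrC divfK//; lra.
  have h2 : `|f x - f y| * `|v| <= e / 3.
    by rewrite -[leRHS]mulr1; apply: ler_pM => //; exact: ltW.
  lra.
have gap0 : (fun n => \int[Pmu]_w (\int[predmu n w]_x Psi n w x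
    - \int[prednu n w]_x Psi n w x)) @ \oo --> (0 : R).
  have bPsi n w : bmf (Psi n w).
    apply: (Cb_bmf polX); split; last by exists (2 * M).
    move=> x e e0; have [r r0 rP] := equi w x (e / 2) ltac:(by rewrite divr_gt0).
    by exists r => // y /rP /(_ n) => le; apply: le_lt_trans le _; lra.
  (* The dominating constant comes from two integrals of [Psi], each bounded by [2 * M]. *)
  apply: (bmf_Int_cvg0 (M := 4 * M)).
  - by move=> n; have [_ _ + _] := sbP n.
  - move=> n w; apply: le_trans (ler_normB _ _) _.
    have := bmf_Int_bound (predmu n w) (bPsi n w) (PsiM n w).
    have := bmf_Int_bound (prednu n w) (bPsi n w) (PsiM n w).
    lra.
  - apply: filterS pred_merge => w merge.
    apply: (uniform_merging polX _ (fun n => PsiM n w) (equi w)).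
    move=> f' Cf'; have bf' := Cb_bmf polX Cf'.
    rewrite (_ : (fun n => _ - _) = fine \o (fun n =>
      \int[predmu n w]_x (f' x)%:E - \int[prednu n w]_x (f' x)%:E)%E).
      exact: fine_cvg (merge f' Cf').
    by apply/funext => n; rewrite /= !bmf_EInt.
rewrite [X in X @ _ --> _](_ : _ = (fun n => (\int[Pmu]_w (\int[predmu n w]_x Psi n w x
    - \int[prednu n w]_x Psi n w x))%:E)); last first.
  apply/funext => n; have [_ _ _ <-] := sbP n.
  rewrite -bmf_EInt; last first.
    have [mX mZ _ _ _] := lawmu.
    have obsm := @obs_measurable _ _ _ _ _ _ _ _ h Xs Zs mh mX mZ n.+1.
    apply: bmf_norm; apply: bmfB.
      exact: (bmf_cond_law obsm (Hfiltmu n)).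
    exact: (bmf_cond_law obsm (Hfiltnu n)).
  by apply: eq_integral => w _; rewrite !bmf_EInt.
apply: cvg_EFin; last exact: gap0.
exact: nearW.
Qed.
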